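(* Let $R$ and $S$ be arbitrary rings and let ${}_RC_S$ be a semidualizing $(R,S)$-bimodule. If ${}_RC$ has an ultimately closed projective resolution, then $$\mathcal{A}_C(S)={C_S}^{\top}={}^{\perp}\mathcal{I}_C(S).$$
   Context: All rings are associative with identity. For a ring $T$, $\operatorname{Mod} T$ is the category of left $T$-modules, and $\operatorname{Mod} T^{op}$ is identified with the category of right $T$-modules. All subcategories are full and closed under isomorphisms. Semidualizing: an $(R,S)$-bimodule ${}_RC_S$ is semidualizing if (a1) ${}_RC$ has a projective resolution by finitely generated projective left $R$-modules; (a2) $C_S$ has a projective resolution by finitely generated projective right $S$-modules; (b1) the homothety map $R\to\operatorname{Hom}_{S^{op}}(C,C)$ is an isomorphism; (b2) the homothety map $S\to\operatorname{Hom}_R(C,C)$ is an isomorphism; (c1) $\operatorname{Ext}_R^{i}(C,C)=0$ for all $i\ge1$; (c2) $\operatorname{Ext}_{S^{op}}^{i}(C,C)=0$ for all $i\geq 1$. Auslander class $\mathcal{A}_C(S)$: all $N\in\operatorname{Mod} S$ such that $\operatorname{Tor}^S_i(C,N)=0$ for all $i\ge1$; $\operatorname{Ext}^i_R(C,C\otimes_SN)=0$ for all $i\ge1$; and the map $\mu_N:N\to\operatorname{Hom}_R(C,C\otimes_SN)$, $\mu_N(x)(c)=c\otimes x$, is an isomorphism. ${C_S}^{\top}:=\{A\in\operatorname{Mod} S\mid \operatorname{Tor}^S_i(C,A)=0\text{ for all }i\ge1\}$. $\mathcal{I}_C(S):=\{\operatorname{Hom}_R(C,I)\mid I\text{ injective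 in }\operatorname{Mod} R\}\subseteq\operatorname{Mod} S$ (the $C$-injective modules), and ${}^{\perp}\mathcal{I}_C(S):=\{A\in\operatorname{Mod} S\mid\operatorname{Ext}_S^i(A,X)=0\text{ for all }i\ge1\text{ and all }X\in\mathcal{I}_C(S)\}$. Ultimately closed: a module $X\in\operatorname{Mod} R$ has an ultimately closed projective resolution at $n$ ($n\ge1$) if there is a projective resolution $\cdots\to P_n\xrightarrow{g_n}P_{n-1}\to\cdots\to P_1\xrightarrow{g_1}P_0\xrightarrow{g_0}X\to0$ in $\operatorname{Mod} R$ such that $\operatorname{Im} g_n\cong\bigoplus_jW_j$, where each $W_j$ is isomorphic to a direct summand of some $\operatorname{Im} g_{i_j}$ with $i_j<n$. $X$ has an ultimately closed projective resolution if it has one at some $n\geq 1$. *)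

(* Defs.v *)
From HB Require Import structures.
From mathcomp Require Import all_boot all_algebra.
From mathcomp Require Import ring_quotient generic_quotient.
From mathcomp Require Import freeg.
From mathcomp Require Import finmap all_classical.

Set Implicit Arguments.
Unset Strict Implicit.
Unset Printing Implicit Defensive.

Import GRing.Theory.
Local Open Scope ring_scope.

(* The category Mod R is [lmodType R]; right R-modules are left modules over  *)
(* the converse ring, [lmodType R^c], with x r = (r : R^c) *: x. Over         *)
(* [pzRingType] the zero ring is allowed. The choice structures carried by    *)
(* MathComp modules exist on every type by the classical axioms of boolp.     *)

Section LinearExt.
Variables (R : pzRingType) (U V : lmodType R).

Lemma linear_ext (f g : {linear U -> V}) : f =1 g -> f = g.
Proof.
move=> fg; have {}fg : (f : U -> V) = g by apply/funext.
case: f g fg => f [[fa] [fs]] [g [[ga] [gs]]] /= fg.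
move: fa fs ga gs; rewrite fg => fa fs ga gs.
by rewrite (Prop_irrelevance fa ga) (Prop_irrelevance fs gs).
Qed.

Definition isomorphic := exists f : {linear U -> V}, bijective f.

End LinearExt.

HB.mixin Record isBimodule (R S : pzRingType) C of GRing.Lmodule R C := {
  rscale : C -> S -> C;
  rscalerA : forall c s t, rscale (rscale c s) t = rscale c (s * t);
  rscaler1 : forall c, rscale c 1 = c;
  rscalerDl : forall c d s, rscale (c + d) s = rscale c s + rscale d s;
  rscalerDr : forall c s t, rscale c (s + t) = rscale c s + rscale c t;
  scaler_rscaler : forall r c s, r *: rscale c s = rscale (r *: c) s
}.

#[short(type="bimodType")]
HB.structure Definition Bimodule (R S : pzRingType) :=
  {C of isBimodule R S C & GRing.Lmodule R C}.

(* The right S-module underlying a bimodule. *)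
Definition right_module (R S : pzRingType) (C : bimodType R S) : Type := C.

Section RightModule.
Variables (R S : pzRingType) (C : bimodType R S).

HB.instance Definition _ := GRing.Zmodule.on (right_module C).

Let scale (s : S^c) (c : right_module C) : right_module C :=
  rscale (c : C) (s : S).

Fact right_scalerA a b c : scale a (scale b c) = scale (a * b) c.
Proof. exact: rscalerA. Qed.

Fact right_scale1r : left_id 1 scale.
Proof. by move=> c; apply: rscaler1. Qed.

Fact right_scalerDr : right_distributive scale +%R.
Proof. by move=> s c d; apply: rscalerDl. Qed.

Fact right_scalerDl c : {morph scale^~ c : a b / a + b}.
Proof. by move=> s t; apply: rscalerDr. Qed.

HB.instance Definition _ := GRing.Zmodule_isLmodule.Build S^c (right_module C)
  right_scalerA right_scale1r right_scalerDr right_scalerDl.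

End RightModule.

Section Homothety.
Variables (R S : pzRingType) (C : bimodType R S).

Definition lhom_fun (r : R) (c : right_module C) : right_module C :=
  r *: (c : C).

Fact lhom_is_linear r : linear (lhom_fun r).
Proof.
move=> s c d; rewrite /lhom_fun scalerDr; congr (_ + _).
exact: scaler_rscaler.
Qed.

HB.instance Definition _ r :=
  GRing.isLinear.Build S^c (right_module C) (right_module C) _ (lhom_fun r)
    (lhom_is_linear r).

Definition rhom_fun (s : S) (c : C) : C := rscale c s.

Fact rhom_is_linear s : linear (rhom_fun s).
Proof. by move=> r c d; rewrite /rhom_fun rscalerDl scaler_rscaler. Qed.

HB.instance Definition _ s :=
  GRing.isLinear.Build R C C _ (rhom_fun s) (rhom_is_linear s).

Definition left_homothety (r : R) : {linear right_module C -> right_module C} :=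
  lhom_fun r.

Definition right_homothety (s : S) : {linear C -> C} := rhom_fun s.

End Homothety.

(* Hom_R(C, M) for a bimodule C, with the left S-action (s f)(c) = f (c s). *)
Definition homC (R S : pzRingType) (C : bimodType R S) (M : lmodType R) :
    Type :=
  {linear C -> M}.

Section HomC.
Variables (R S : pzRingType) (C : bimodType R S) (M : lmodType R).
Local Notation H := (homC C M).

HB.instance Definition _ := gen_eqMixin H.
HB.instance Definition _ := gen_choiceMixin H.

Definition homC_zero : H := (\0 : {linear C -> M}).
Definition homC_add (f g : H) : H :=
  ((f : {linear C -> M}) \+ (g : {linear C -> M}) : {linear C -> M}).
Definition homC_opp (f : H) : H := (\- (f : {linear C -> M}) : {linear C -> M}).
Definition homC_scale (s : S) (f : H) : H :=
  ((f : {linear C -> M}) \o right_homothety C s : {linear C -> M}).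

Fact homC_addA : associative homC_add.
Proof. by move=> f g h; apply: linear_ext => c /=; rewrite addrA. Qed.
Fact homC_addC : commutative homC_add.
Proof. by move=> f g; apply: linear_ext => c /=; rewrite addrC. Qed.
Fact homC_add0 : left_id homC_zero homC_add.
Proof. by move=> f; apply: linear_ext => c /=; rewrite add0r. Qed.
Fact homC_addN : left_inverse homC_zero homC_opp homC_add.
Proof. by move=> f; apply: linear_ext => c /=; rewrite addNr. Qed.

HB.instance Definition _ := GRing.isZmodule.Build H
  homC_addA homC_addC homC_add0 homC_addN.

Fact homC_scaleA s t (f : H) :
  homC_scale s (homC_scale t f) = homC_scale (s * t) f.
Proof. by apply: linear_ext => c /=; rewrite /rhom_fun rscalerA. Qed.
Fact homC_scale1 : left_id 1 homC_scale.
Proof. by move=> f; apply: linear_ext => c /=; rewrite /rhom_fun rscaler1. Qed.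
Fact homC_scaleDr : right_distributive homC_scale +%R.
Proof. by move=> s f g; apply: linear_ext. Qed.
Fact homC_scaleDl (f : H) : {morph homC_scale^~ f : s t / s + t}.
Proof.
by move=> s t; apply: linear_ext => c /=; rewrite /rhom_fun rscalerDr raddfD.
Qed.

HB.instance Definition _ := GRing.Zmodule_isLmodule.Build S H
  homC_scaleA homC_scale1 homC_scaleDr homC_scaleDl.

End HomC.

(* M \otimes_S N is the free abelian group on M * N modulo the bilinear and   *)
(* balancing relations; [s *: m] with [s : S^c] is m s.                       *)
Section Tensor.
Variables (S : pzRingType) (M : lmodType S^c) (N : lmodType S).
Local Notation F := {freeg (M * N)%type / int}.
Local Notation "m '#' n" := (<< (m, n) >> : F) (at level 20).

Inductive tensor_rel : F -> Prop :=
| tensor_rel0 : tensor_rel 0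
| tensor_relB x y : tensor_rel x -> tensor_rel y -> tensor_rel (x - y)
| tensor_relDl m m' n : tensor_rel ((m + m') # n - m # n - m' # n)
| tensor_relDr m n n' : tensor_rel (m # (n + n') - m # n - m # n')
| tensor_relM m (s : S) n :
    tensor_rel (((s : S^c) *: m) # n - m # (s *: n)).

Definition tensor_relb : {pred F} := fun x => `[< tensor_rel x >].

Fact tensor_relb_closed : zmod_closed tensor_relb.
Proof.
split=> [|x y /asboolP rx /asboolP ry]; apply/asboolP.
  exact: tensor_rel0.
exact: tensor_relB.
Qed.

HB.instance Definition _ :=
  GRing.isZmodClosed.Build F tensor_relb tensor_relb_closed.

Definition tensor : Type := Quotient.quot tensor_relb.
HB.instance Definition _ := GRing.Zmodule.on tensor.

Definition tens (m : M) (n : N) : tensor :=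
  (\pi_(Quotient.quot tensor_relb) (m # n))%qT.


Lemma tensor_eq (x y : F) : tensor_rel (x - y) ->
  (\pi_(Quotient.quot tensor_relb) x)%qT
  = (\pi_(Quotient.quot tensor_relb) y)%qT :> tensor.
Proof. by move=> r; apply/eqP; rewrite -Quotient.idealrBE; apply/asboolP. Qed.

Lemma tensDl m m' n : tens (m + m') n = tens m n + tens m' n.
Proof.
rewrite /tens -[RHS]raddfD; apply: tensor_eq.
by rewrite opprD addrA; apply: tensor_relDl.
Qed.

Lemma tensDr m n n' : tens m (n + n') = tens m n + tens m n'.
Proof.
rewrite /tens -[RHS]raddfD; apply: tensor_eq.
by rewrite opprD addrA; apply: tensor_relDr.
Qed.

Lemma tensM m (s : S) n : tens ((s : S^c) *: m) n = tens m (s *: n).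
Proof. by apply: tensor_eq; apply: tensor_relM. Qed.

(* The additive map induced by a balanced biadditive one. *)
Section Lift.
Variables (A : zmodType) (b : M -> N -> A).

Definition tensor_lift (t : tensor) : A :=
  fglift (fun p : M * N => b p.1 p.2 : ssrint.zmodule A)
    (repr (t : Quotient.quot tensor_relb)).

Hypotheses (bDl : forall m m' n, b (m + m') n = b m n + b m' n)
  (bDr : forall m n n', b m (n + n') = b m n + b m n')
  (bM : forall m (s : S) n, b ((s : S^c) *: m) n = b m (s *: n)).

Let lift : F -> A := fglift (fun p : M * N => b p.1 p.2 : ssrint.zmodule A).

Let liftB : {morph lift : x y / x - y}.
Proof.
exact: (lift_is_additive (fun p : M * N => b p.1 p.2 : ssrint.zmodule A)).
Qed.

Let lift0 : lift 0 = 0.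
Proof. by have := liftB 0 0; rewrite !subrr. Qed.

Let lift1 m n : lift (m # n) = b m n.
Proof.
by rewrite /lift liftU; exact: (@scale1r _ (ssrint.zmodule A) (b m n)).
Qed.

Let lift_rel x : tensor_rel x -> lift x = 0.
Proof.
elim=> [|{}x y _ x0 _ y0|m m' n|m n n'|m s n].
- exact: lift0.
- by rewrite liftB x0 y0 subrr.
- by rewrite !liftB !lift1 bDl -addrA -opprD subrr.
- by rewrite !liftB !lift1 bDr -addrA -opprD subrr.
- by rewrite liftB !lift1 bM subrr.
Qed.

Let lift_pi x : tensor_lift (\pi_(Quotient.quot tensor_relb) x)%qT = lift x.
Proof.
apply/eqP; rewrite -subr_eq0 -liftB; apply/eqP/lift_rel/asboolP.
by rewrite -[ `[< _ >]]/(_ \in tensor_relb) Quotient.idealrBE reprK.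
Qed.

Lemma tensor_liftE m n : tensor_lift (tens m n) = b m n.
Proof. by rewrite lift_pi lift1. Qed.

Lemma tensor_lift_is_zmod_morphism : zmod_morphism tensor_lift.
Proof.
move=> x y; rewrite -[x]reprK -[y]reprK -[X in tensor_lift X]raddfB.
by rewrite !lift_pi liftB.
Qed.

End Lift.

Lemma tensor_ind (P : tensor -> Prop) :
  P 0 -> (forall x y, P x -> P y -> P (x - y)) -> (forall m n, P (tens m n)) ->
  forall t, P t.
Proof.
move=> P0 PB Pt t; rewrite -[t]reprK; set x := repr _.
have PN u : P u -> P (- u) by move=> Pu; rewrite -sub0r; apply: PB.
have PD u v : P u -> P v -> P (u + v).
  by move=> Pu Pv; rewrite -[v]opprK; apply/PB/PN.
rewrite -(freeg_sumE x) raddf_sum; elim/big_ind: _ => // -[m n] _.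
have -> (c : int) : << c *g (m, n) >> = (m # n) *~ c.
  by rewrite freegU_mulz intz.
rewrite raddfMz; rewrite -/(tens m n).
have Pun k : P (tens m n *+ k).
  by elim: k => [//|k IHk]; rewrite mulrS; apply: PD => //; apply: Pt.
by case: (coeff _ _) => k; [|apply: PN]; apply: Pun.
Qed.

End Tensor.

Section TensorMap.
Variables (S : pzRingType) (M M' : lmodType S^c) (N N' : lmodType S).
Variables (f : {linear M -> M'}) (g : {linear N -> N'}).

Definition tensor_map : tensor M N -> tensor M' N' :=
  tensor_lift (fun m n => tens (f m) (g n)).

Let mapDl m m' n :
  tens (f (m + m')) (g n) = tens (f m) (g n) + tens (f m') (g n).
Proof. by rewrite raddfD tensDl. Qed.
Let mapDr m n n' :
  tens (f m) (g (n + n')) = tens (f m) (g n) + tens (f m) (g n').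
Proof. by rewrite raddfD tensDr. Qed.
Let mapM m (s : S) n :
  tens (f ((s : S^c) *: m)) (g n) = tens (f m) (g (s *: n)).
Proof. by rewrite !linearZ tensM. Qed.

Lemma tensor_mapE m n : tensor_map (tens m n) = tens (f m) (g n).
Proof. exact: tensor_liftE mapDl mapDr mapM _ _. Qed.

HB.instance Definition _ := GRing.isZmodMorphism.Build _ _ tensor_map
  (tensor_lift_is_zmod_morphism mapDl mapDr mapM).

End TensorMap.

(* C \otimes_S N with the left R-action r (c \otimes n) = r c \otimes n.      *)
Definition tensorC (R S : pzRingType) (C : bimodType R S) (N : lmodType S) :
    Type :=
  tensor (right_module C) N.

Section TensorC.
Variables (R S : pzRingType) (C : bimodType R S) (N : lmodType S).

HB.instance Definition _ := GRing.Zmodule.on (tensorC C N).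

Definition tensorC_scale (r : R) : tensorC C N -> tensorC C N :=
  tensor_map (left_homothety C r) (idfun : {linear N -> N}).

Fact tensorC_scaleE r (c : right_module C) n :
  tensorC_scale r (tens c n) = tens (left_homothety C r c) n.
Proof. exact: tensor_mapE. Qed.

Fact tensorC_scaleB r : {morph tensorC_scale r : x y / x - y}.
Proof. exact: (raddfB (tensor_map _ _)). Qed.

Fact tensorC_scale0 r : tensorC_scale r 0 = 0.
Proof. exact: (raddf0 (tensor_map _ _)). Qed.

Fact tensorC_scaleDr : right_distributive tensorC_scale +%R.
Proof. by move=> r x y; exact: (raddfD (tensor_map _ _)). Qed.

Fact tensorC_scaleA r r' t :
  tensorC_scale r (tensorC_scale r' t) = tensorC_scale (r * r') t.
Proof.
elim/tensor_ind: t => [|x y IHx IHy|c n]; first by rewrite !tensorC_scale0.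
  by rewrite !tensorC_scaleB IHx IHy.
by rewrite !tensorC_scaleE; congr tens; exact: (@scalerA R C).
Qed.

Fact tensorC_scale1 : left_id 1 tensorC_scale.
Proof.
elim/tensor_ind=> [|x y IHx IHy|c n]; first exact: tensorC_scale0.
  by rewrite tensorC_scaleB IHx IHy.
by rewrite tensorC_scaleE; congr tens; exact: (@scale1r R C).
Qed.

Fact tensorC_scaleDl t : {morph tensorC_scale^~ t : r r' / r + r'}.
Proof.
move=> r r'; elim/tensor_ind: t => [|x y IHx IHy|c n].
- by rewrite !tensorC_scale0 addr0.
- by rewrite !tensorC_scaleB IHx IHy opprD addrACA.
- by rewrite !tensorC_scaleE -tensDl; congr tens; exact: (@scalerDl R C).
Qed.

HB.instance Definition _ := GRing.Zmodule_isLmodule.Build R (tensorC C N)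
  tensorC_scaleA tensorC_scale1 tensorC_scaleDr tensorC_scaleDl.

Definition mu_fun (x : N) (c : C) : tensorC C N := tens (c : right_module C) x.

Fact mu_fun_is_linear x : linear (mu_fun x).
Proof.
move=> r c d; rewrite /mu_fun tensDl; congr (_ + _); exact/esym/tensorC_scaleE.
Qed.

HB.instance Definition _ x :=
  GRing.isLinear.Build R C (tensorC C N) _ (mu_fun x) (mu_fun_is_linear x).

Definition mu (x : N) : homC C (tensorC C N) :=
  (mu_fun x : {linear C -> tensorC C N}).

End TensorC.

Section Image.
Variables (R : pzRingType) (U V : lmodType R) (f : {linear U -> V}).

Definition in_image : {pred V} := fun y => `[< exists x, f x = y >].

Fact in_image_closed : submod_closed in_image.
Proof.
split=> [|r _ _ /asboolP[x <-] /asboolP[y <-]]; apply/asboolP.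
  by exists 0; rewrite raddf0.
by exists (r *: x + y); rewrite linearP.
Qed.

HB.instance Definition _ := GRing.isSubmodClosed.Build R V in_image
  in_image_closed.

Record image_module : Type :=
  ImageModule { image_val : V; _ : image_val \in in_image }.

HB.instance Definition _ := [isSub for image_val].
HB.instance Definition _ := [Choice of image_module by <:].
HB.instance Definition _ := [SubChoice_isSubLmodule of image_module by <:].

End Image.

(* The external direct sum of a family: the finitely supported elements of    *)
(* the product.                                                               *)
Section DirectSum.
Variables (R : pzRingType) (J : Type) (W : J -> lmodType R).

Definition dprod : Type := forall j, W j.

HB.instance Definition _ := Choice.on dprod.

Lemma dprod_ext (x y : dprod) : (forall j, x j = y j) -> x = y.
Proof. exact: functional_extensionality_dep. Qed.

Definition dprod_zero : dprod := fun=> 0.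
Definition dprod_add (x y : dprod) : dprod := fun j => x j + y j.
Definition dprod_opp (x : dprod) : dprod := fun j => - x j.
Definition dprod_scale (r : R) (x : dprod) : dprod := fun j => r *: x j.

Fact dprod_addA : associative dprod_add.
Proof. by move=> x y z; apply: dprod_ext => j; apply: addrA. Qed.
Fact dprod_addC : commutative dprod_add.
Proof. by move=> x y; apply: dprod_ext => j; apply: addrC. Qed.
Fact dprod_add0 : left_id dprod_zero dprod_add.
Proof. by move=> x; apply: dprod_ext => j; apply: add0r. Qed.
Fact dprod_addN : left_inverse dprod_zero dprod_opp dprod_add.
Proof. by move=> x; apply: dprod_ext => j; apply: addNr. Qed.

HB.instance Definition _ := GRing.isZmodule.Build dprod
  dprod_addA dprod_addC dprod_add0 dprod_addN.

Fact dprod_scaleA a b x :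
  dprod_scale a (dprod_scale b x) = dprod_scale (a * b) x.
Proof. by apply: dprod_ext => j; apply: scalerA. Qed.
Fact dprod_scale1 : left_id 1 dprod_scale.
Proof. by move=> x; apply: dprod_ext => j; apply: scale1r. Qed.
Fact dprod_scaleDr : right_distributive dprod_scale +%R.
Proof. by move=> r x y; apply: dprod_ext => j; apply: scalerDr. Qed.
Fact dprod_scaleDl x : {morph dprod_scale^~ x : a b / a + b}.
Proof. by move=> a b; apply: dprod_ext => j; apply: scalerDl. Qed.

HB.instance Definition _ := GRing.Zmodule_isLmodule.Build R dprod
  dprod_scaleA dprod_scale1 dprod_scaleDr dprod_scaleDl.

Definition in_dsum : {pred dprod} :=
  fun x => `[< finite_set [set j | x j <> 0]%classic >].

Fact in_dsum_closed : submod_closed in_dsum.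
Proof.
split=> [|r x y /asboolP fx /asboolP fy]; apply/asboolP.
  by rewrite (_ : [set _ | _]%classic = set0) // -subset0 => j /=.
have fxy : finite_set ([set j | x j <> 0] `|` [set j | y j <> 0])%classic.
  by rewrite finite_setU.
apply: sub_finite_set fxy => j /= xy_neq0.
have [xj0|] := pselect (x j = 0); last by left.
right=> yj0; apply: xy_neq0.
by rewrite -[LHS]/(r *: x j + y j) xj0 yj0 scaler0 addr0.
Qed.

HB.instance Definition _ := GRing.isSubmodClosed.Build R dprod in_dsum
  in_dsum_closed.

Record dsum : Type := DSum { dsum_val : dprod; _ : dsum_val \in in_dsum }.

HB.instance Definition _ := [isSub for dsum_val].
HB.instance Definition _ := [Choice of dsum by <:].
HB.instance Definition _ := [SubChoice_isSubLmodule of dsum by <:].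

End DirectSum.

Definition surjective (A B : Type) (f : A -> B) := forall y, exists x, f x = y.

Section Homological.
Variable R : pzRingType.

Definition projective (P : lmodType R) :=
  forall (M N : lmodType R) (p : {linear M -> N}) (f : {linear P -> N}),
    surjective p -> exists g : {linear P -> M}, p \o g =1 f.

Definition injective_module (I : lmodType R) :=
  forall (M N : lmodType R) (i : {linear M -> N}) (f : {linear M -> I}),
    injective i -> exists g : {linear N -> I}, g \o i =1 f.

Definition finitely_generated (M : lmodType R) :=
  exists (n : nat) (e : 'I_n -> M),
    forall x, exists a : 'I_n -> R, x = \sum_(i < n) a i *: e i.

(* [res_aug] is g_0 : P_0 -> X and [res_d n] is g_(n+1) : P_(n+1) -> P_n.     *)
Record projective_resolution (X : lmodType R) := ProjectiveResolution {
  res_obj : nat -> lmodType R;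
  res_d : forall n, {linear res_obj n.+1 -> res_obj n};
  res_aug : {linear res_obj 0%N -> X};
  res_projective : forall n, projective (res_obj n);
  res_aug_surj : surjective res_aug;
  res_exact0 : forall x, res_aug x = 0 <-> exists y, res_d 0%N y = x;
  res_exactS : forall n x,
    res_d n x = 0 <-> exists y, res_d n.+1 y = x
}.

(* The module Im g_n; in particular Im g_0 is (a copy of) X. *)
Definition res_image (X : lmodType R) (P : projective_resolution X) (n : nat) :
    lmodType R :=
  match n with
  | 0 => image_module (res_aug P)
  | k.+1 => image_module (res_d P k)
  end.

(* Ext^i_R(M, N) = 0: the complex Hom_R(P, N) has no cohomology in degree i,  *)
(* P being any projective resolution of M.                                    *)
Definition Ext_vanishes (i : nat) (M N : lmodType R) :=
  forall P : projective_resolution M,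
    match i with
    | 0 => forall f : {linear res_obj P 0%N -> N},
        (forall x, f (res_d P 0%N x) = 0) -> forall x, f x = 0
    | k.+1 => forall f : {linear res_obj P k.+1 -> N},
        (forall x, f (res_d P k.+1 x) = 0) ->
        exists g : {linear res_obj P k -> N}, forall x, f x = g (res_d P k x)
    end.

Definition iso_to_summand (W M : lmodType R) :=
  exists V : lmodType R, isomorphic M (W * V)%type.

Definition ultimately_closed_at (X : lmodType R) (n : nat) :=
  exists (P : projective_resolution X) (J : Type) (W : J -> lmodType R),
    isomorphic (res_image P n) (dsum W) /\
    forall j, exists i, (i < n)%N /\ iso_to_summand (W j) (res_image P i).

Definition ultimately_closed (X : lmodType R) :=
  exists n, (1 <= n)%N /\ ultimately_closed_at X n.

End Homological.

(* Tor^S_i(M, N) = 0: the complex M \otimes_S P has no homology in degree i,  *)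
(* P being any projective resolution of N.                                    *)
Definition Tor_vanishes (S : pzRingType) (i : nat) (M : lmodType S^c)
    (N : lmodType S) :=
  forall P : projective_resolution N,
    let d n := tensor_map (idfun : {linear M -> M}) (res_d P n) in
    match i with
    | 0 => forall t, exists u, t = d 0%N u
    | k.+1 => forall t, d k t = 0 -> exists u, t = d k.+1 u
    end.

Definition fg_projective_resolution (R : pzRingType) (M : lmodType R) :=
  exists P : projective_resolution M,
    forall n, finitely_generated (res_obj P n).

Record semidualizing (R S : pzRingType) (C : bimodType R S) : Prop := {
  semidualizing_a1 : fg_projective_resolution (C : lmodType R);
  semidualizing_a2 : fg_projective_resolution (right_module C : lmodType S^c);
  semidualizing_b1 : bijective (left_homothety C);
  semidualizing_b2 : bijective (right_homothety C);
  semidualizing_c1 : forall i, (1 <= i)%N ->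
    Ext_vanishes i (C : lmodType R) (C : lmodType R);
  semidualizing_c2 : forall i, (1 <= i)%N ->
    Ext_vanishes i (right_module C : lmodType S^c)
      (right_module C : lmodType S^c)
}.

Section Classes.
Variables (R S : pzRingType) (C : bimodType R S).

Definition C_top (N : lmodType S) :=
  forall i, (1 <= i)%N -> Tor_vanishes i (right_module C : lmodType S^c) N.

Definition Auslander_class (N : lmodType S) :=
  [/\ forall i, (1 <= i)%N -> Tor_vanishes i (right_module C : lmodType S^c) N,
      forall i, (1 <= i)%N ->
        Ext_vanishes i (C : lmodType R) (tensorC C N : lmodType R)
    & bijective (@mu R S C N)].

Definition C_injective (X : lmodType S) :=
  exists I : lmodType R,
    injective_module I /\ isomorphic X (homC C I : lmodType S).

Definition perp_C_injective (N : lmodType S) :=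
  forall X, C_injective X -> forall i, (1 <= i)%N -> Ext_vanishes i N X.

End Classes.

(* Every module has a projective resolution by free modules, so the           *)
(* quantification over resolutions in [Ext_vanishes] and [Tor_vanishes] is    *)
(* never vacuous.                                                             *)
Local Open Scope classical_set_scope.

Section Free.
Variables (R : pzRingType) (X : choiceType).
Definition free_module : lmodType R := dsum (fun _ : X => R^o).
Definition free_coef (x : free_module) (j : X) : R := dsum_val x j.
Definition free_supp (x : free_module) : set X := [set j | free_coef x j <> 0].
Lemma free_supp_fin x : finite_set (free_supp x).
Proof. case: x => x px; have /asboolP := px; exact. Qed.

Fact free_gen_in (j : X) :
  (fun k => (k == j)%:R : R) \in
    @in_dsum R X (fun _ : X => (R^o : lmodType R)).
Proof.
apply/asboolP; apply: (@sub_finite_set _ _ [set j]) => // k /=.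
by case: eqP.
Qed.
Definition free_gen j : free_module := DSum (free_gen_in j).

Section FL.
Variables (M : lmodType R) (h : X -> M).
Definition free_lift (x : free_module) : M :=
  \sum_(j \in setT) (free_coef x j *: h j : M).
Lemma free_liftE (A : set X) x : finite_set A -> free_supp x `<=` A ->
  free_lift x = \sum_(j \in A) (free_coef x j *: h j : M).
Proof.
move=> fA sA; rewrite /free_lift; apply/esym/fsbig_widen => // j [_ /= nA].
rewrite (_ : free_coef x j = 0) ?scale0r //.
by apply: contrapT => xj; apply/nA/sA.
Qed.
Lemma free_lift_linear : linear free_lift.
Proof.
move=> r x y.
have fA : finite_set (free_supp x `|` free_supp y).
  by rewrite finite_setU; split; apply: free_supp_fin.
rewrite !(free_liftE fA); first last.
- move=> j; rewrite /free_supp /= => xj.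
  have [xj0|] := pselect (free_coef x j = 0); last by left.
  right=> yj0; apply: xj; rewrite -[LHS]/(r * free_coef x j + free_coef y j).
  by rewrite xj0 yj0 mulr0 addr0.
- by move=> j; left.
- by move=> j; right.
rewrite !fsbig_finite //= scaler_sumr -big_split /=.
apply: eq_bigr => j _.
transitivity ((r * free_coef x j + free_coef y j) *: h j); first by [].
by rewrite scalerDl scalerA.
Qed.
HB.instance Definition _ := GRing.isLinear.Build R free_module M _ free_lift
  free_lift_linear.
Lemma free_lift1 j : free_lift (free_gen j) = h j.
Proof.
rewrite (@free_liftE [set j]) //; last first.
  by move=> k; rewrite /free_supp /=; case: eqP.
by rewrite fsbig_set1 /= eqxx scale1r.
Qed.
End FL.

Lemma free_ext (M : lmodType R) (f g : {linear free_module -> M}) :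
  (forall j, f (free_gen j) = g (free_gen j)) -> f =1 g.
Proof.
move=> fg x.
have E : x = free_lift free_gen x.
  apply: val_inj; apply: funext => k.
  rewrite (free_liftE _ (free_supp_fin x) (@subset_refl _ _)).
  rewrite fsbig_finite /=; last exact: free_supp_fin.
  have -> (s : seq X) (F : X -> free_module) :
      dsum_val (\sum_(i <- s) F i) k
      = \sum_(i <- s) dsum_val (F i) k.
    by elim/big_ind2: _ => // a b c d <- <-.
  rewrite (eq_bigr (fun i => free_coef x i * (k == i)%:R)) //.
  have U := fset_uniq (fset_set (free_supp x)).
  have [ks|ks] := boolP (k \in fset_set (free_supp x)).
    rewrite (bigD1_seq k) //= eqxx mulr1 big1 ?addr0 // => i.
    by rewrite eq_sym => /negbTE ->; rewrite mulr0.
  rewrite big_seq big1 => [|i si].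
    move: ks; rewrite in_fset_set; last exact: free_supp_fin.
    by move=> /negP; rewrite inE => nk; apply: contrapT.
  by case: eqP => [ki|_]; [rewrite -ki (negbTE ks) in si|rewrite mulr0].
rewrite E.
rewrite (free_liftE _ (free_supp_fin x) (@subset_refl _ _)).
rewrite fsbig_finite /=; last exact: free_supp_fin.
by rewrite !linear_sum; apply: eq_bigr => j _; rewrite !linearZ fg.
Qed.

Lemma free_projective : projective free_module.
Proof.
move=> M N p f sp.
have /choice[h ph] : forall j, exists m, p m = f (free_gen j).
  by move=> j; apply: sp.
exists (free_lift h) => /=.
apply: (@free_ext N (p \o free_lift h : {linear free_module -> N})) => j /=.
by rewrite free_lift1.
Qed.
End Free.

Section Ker.
Variables (R : pzRingType) (U V : lmodType R) (f : {linear U -> V}).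
Definition in_ker : {pred U} := fun x => f x == 0.
Fact in_ker_closed : submod_closed in_ker.
Proof.
split=> [|r x y /eqP fx /eqP fy]; apply/eqP; rewrite ?raddf0 //.
by rewrite linearP fx fy scaler0 addr0.
Qed.
HB.instance Definition _ := GRing.isSubmodClosed.Build R U in_ker
  in_ker_closed.
Record ker : Type := Ker { ker_val : U; _ : ker_val \in in_ker }.
HB.instance Definition _ := [isSub for ker_val].
HB.instance Definition _ := [Choice of ker by <:].
HB.instance Definition _ := [SubChoice_isSubLmodule of ker by <:].
End Ker.

Lemma projective_resolution_exists (R : pzRingType) (M : lmodType R) :
  inhabited (projective_resolution M).
Proof.
pose eps (N : lmodType R) : {linear free_module R N -> N} := free_lift id.
pose K := fix K n : lmodType R := if n is k.+1 then ker (eps (K k)) else M.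
pose d n : {linear free_module R (K n.+1) -> free_module R (K n)} :=
  ((val : ker (eps (K n)) -> free_module R (K n)) \o eps (K n.+1)).
have epsS N : surjective (eps N).
  by move=> y; exists (free_gen R y); apply: free_lift1.
constructor.
apply: (@ProjectiveResolution R M (fun n => free_module R (K n)) d (eps M)).
- by move=> n; apply: free_projective.
- exact: epsS.
- move=> x; split=> [ex|[y <-]].
    have kx : x \in in_ker (eps M) by apply/eqP.
    have [y ey] := epsS (K 1%N) (Ker kx); exists y; rewrite /d /=.
    by have := congr1 val ey.
  by rewrite /d /=; case: (eps _ y) => z pz; have /eqP := pz.
- move=> n x; split=> [ex|[y <-]].
    have kx : x \in in_ker (eps (K n.+1)).
      apply/eqP; apply: val_inj; exact: ex.
    have [y ey] := epsS (K n.+2) (Ker kx); exists y; rewrite /d /=.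
    by have := congr1 val ey.
  rewrite /d /=; case: (eps _ y) => z pz; have /eqP ez := pz.
  by have := congr1 val ez.
Qed.

(* Main.v *)
Require Import Defs.
From HB Require Import structures.
From mathcomp Require Import all_boot all_order all_algebra.
From mathcomp Require Import ring_quotient generic_quotient.
From mathcomp Require Import finmap all_classical.

Set Implicit Arguments.
Unset Strict Implicit.
Unset Printing Implicit Defensive.

Import Order.TTheory GRing.Theory Num.Theory.
Local Open Scope ring_scope.

(* Let Q be a projective resolution of N with Tor_i(C, N) = 0 for i >= 1. Then
   C (x) Q is an exact complex with syzygies X_0 = C (x) N, X_1, X_2, ... As mu
   is bijective on projectives and Ext^i(C, C (x) Q_j) = 0 for i >= 1,
   Ext^1(C, X_m) = 0 for m >= 3, and dimension shifting gives
   Ext^i(C, X_m) = 0 for 1 <= i <= m - 2. If the resolution of C is ultimately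
   closed at n, vanishing of n consecutive Ext^i(C, X) forces the vanishing of
   all later ones, so Ext^i(C, X_(n+3)) = 0 for all i >= 1. Shifting back down,
   Ext^i(C, X_m) = 0 for all i >= 1 and all m <= n + 3: m = 0 is the Ext
   condition of the Auslander class, and m = 1, 2 make Hom(C, -) exact on
   C (x) Q_1 -> C (x) Q_0 -> C (x) N -> 0, so mu_N is bijective since mu_(Q_0)
   and mu_(Q_1) are.
   The second equality is the adjunction
   Hom_S(Q, Hom_R(C, I)) = Hom_R(C (x) Q, I): the functor Hom_R(-, I) is exact
   for I injective, and I = Hom_Z(R, Q/Z) detects homology.
   Ext is handled without long exact sequences: for a short exact sequence
   0 -> X -> I -> Z -> 0 with I injective, Ext^1(M, X) = 0 says that all maps
   M -> Z lift to I, which is visibly stable under direct sums and summands. *)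

(** * Divisible groups and injective modules *)

(** Division with remainder by the least positive element of [K]; without positive elements [K] is
    zero and [n = 0]. *)
Lemma int_subgroup_principal (K : int -> Prop) :
  K 0 -> (forall k l, K k -> K l -> K (k - l)) ->
  exists n : nat, forall k, K k <-> exists q, k = q * n%:Z.
Proof.
move=> K0 KB.
have KN k : K k -> K (- k) by move=> Kk; rewrite -sub0r; apply: KB.
have KM k q : K k -> K (q * k).
  move=> Kk; have Kn n : K (n%:Z * k).
    elim: n => [|n IHn]; rewrite ?mul0r // intS mulrDl mul1r.
    by rewrite -[_ * k]opprK; apply/KB/KN.
  by case: q => n; rewrite ?NegzE ?mulNr //; apply: KN.
have [[n0 Kn0]|nK] := pselect (exists n : nat, K n.+1%:Z); last first.
  exists 0%N => k; split=> [|[q ->]]; last by rewrite mulr0.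
  case: k => [[|n]|n] Kk; first by exists 0.
    by case: nK; exists n.
  by case: nK; exists n; have := KN _ Kk; rewrite NegzE opprK.
have exn : exists n, `[< K n.+1%:Z >] by exists n0; apply/asboolP.
case: (ex_minnP exn) => n /asboolP Kn minn; exists n.+1 => k.
split=> [Kk|[q ->]]; last exact: KM.
exists (k %/ n.+1%:Z)%Z; rewrite [LHS](divz_eq k n.+1%:Z).
have : K (k %% n.+1%:Z)%Z.
  have := KB _ _ Kk (KM _ (k %/ n.+1%:Z)%Z Kn).
  by rewrite [X in X - _](divz_eq k n.+1%:Z) addrAC subrr add0r.
have : 0 <= (k %% n.+1%:Z)%Z by apply: modz_ge0.
have : (k %% n.+1%:Z)%Z < n.+1%:Z by apply: ltz_pmod.
case: (k %% _)%Z => // -[|r] r_lt _ Kr; first by rewrite addr0.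
have := minn r; rewrite leqNgt -ltnS -ltz_nat r_lt => /(_ _)/negP; case=> //.
exact/asboolP.
Qed.

Definition divisible (D : zmodType) :=
  forall n (d : D), exists e, e *+ n.+1 = d.

Section AdditiveExtension.
Variables M D : zmodType.
Hypothesis D_divisible : divisible D.
Local Open Scope classical_set_scope.

(* The graphs of the homomorphisms from a subgroup of M to D. *)
Record functional_subgroup (G : set (M * D)) : Prop := {
  functional0 : G 0;
  functionalB : forall p q, G p -> G q -> G (p - q);
  functional_eq0 : forall d, G (0, d) -> d = 0
}.

Lemma functionalN G p : functional_subgroup G -> G p -> G (- p).
Proof.
move=> gG Gp; rewrite -[- p]sub0r.
exact: functionalB gG _ _ (functional0 gG) Gp.
Qed.

Lemma functionalD G p q : functional_subgroup G -> G p -> G q -> G (p + q).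
Proof.
move=> gG Gp Gq; rewrite -[q]opprK.
by apply: functionalB => //; apply: functionalN.
Qed.

Lemma functionalMz G p (k : int) : functional_subgroup G -> G p -> G (p *~ k).
Proof.
move=> gG Gp.
have Gn n : G (p *+ n).
  elim: n => [|n IHn]; first exact: functional0 gG.
  by rewrite mulrS; apply: functionalD.
by case: k => n; [apply: Gn | apply: functionalN (Gn _)].
Qed.

Lemma functional_det G m d d' :
  functional_subgroup G -> G (m, d) -> G (m, d') -> d = d'.
Proof.
move=> gG Gd Gd'; apply/eqP; rewrite -subr_eq0; apply/eqP.
apply: (functional_eq0 gG).
by rewrite -[0 in X in G X](subrr m); apply: (functionalB gG Gd Gd').
Qed.

(** Zorn's lemma: the union of a chain of graphs is a graph, since any two of its points already lie
    in one member. *)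
Lemma functional_subgroup_maximal G0 : functional_subgroup G0 ->
  exists G, [/\ functional_subgroup G, G0 `<=` G
    & forall H, functional_subgroup H -> G `<=` H -> H `<=` G].
Proof.
(* Asking that [G0] together with [A] be a graph, rather than that [A] contain [G0], lets the empty
   chain have the admissible union [set0]. *)
move=> gG0; pose P := [set A | functional_subgroup (G0 `|` A)].
have [F sFP totF|A [PA maxA]] := @Zorn_bigcup _ P.
  have PF p q :
      (G0 `|` \bigcup_(X in F) X) p -> (G0 `|` \bigcup_(X in F) X) q ->
      exists A, [/\ A `<=` \bigcup_(X in F) X, P A,
                     (G0 `|` A) p & (G0 `|` A) q].
    move=> [Gp|[A FA Ap]] [Gq|[B FB Bq]].
    - by exists set0; split=> //; [rewrite /P /= setU0 | left | left].
    - by exists B; split; [exact: bigcup_sup | exact: sFP | left | right].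
    - by exists A; split; [exact: bigcup_sup | exact: sFP | right | left].
    - have [AB|BA] := totF _ _ FA FB.
        exists B; split; [exact: bigcup_sup | exact: sFP | | by right].
        by right; apply: AB.
      exists A; split; [exact: bigcup_sup | exact: sFP | by right |].
      by right; apply: BA.
  split=> [|p q Gp Gq|d Gd]; first by left; exact: functional0 gG0.
    have [A [sA PA Ap Aq]] := PF p q Gp Gq.
    by case: (functionalB PA Ap Aq) => [|/sA]; [left | right].
  by have [A [_ PA Ad _]] := PF _ _ Gd Gd; exact: functional_eq0 PA _ Ad.
exists (G0 `|` A); split=> // H gH sGH p Hp.
have sAH : A `<=` H by move=> q Aq; apply: sGH; right.
have PH : P H by rewrite /P /= setUidr // => q ?; apply: sGH; left.
right; apply: contrapT => nAp; apply: (maxA H) PH.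
by split=> // /(_ p Hp).
Qed.

(** The multiples of [m] in the domain of [G] are those of some [n m]. The value of [G] at [n m],
    divided by [n], is a consistent value [e] at [m]. *)
Lemma functional_subgroup_adjoin G m : functional_subgroup G ->
  exists H e, [/\ functional_subgroup H, G `<=` H & H (m, e)].
Proof.
move=> gG.
suff [e He] : exists e, forall (k : int) d, G (m *~ k, d) -> d = e *~ k.
  exists [set p | exists k : int, G (p.1 + m *~ k, p.2 + e *~ k)], e; split.
  - split=> [|p q [k Gp] [l Gq]|d [k]].
    + by exists 0; rewrite /= !mulr0z !addr0; exact: functional0 gG.
    + exists (k - l); have := functionalB gG Gp Gq.
      by congr G; congr (_, _); rewrite /= mulrzBr opprD !addrA;
        rewrite -!addrA; congr (_ + _); rewrite addrCA.
    + rewrite /= add0r => /He/eqP.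
      by rewrite -subr_eq0 addrK => /eqP.
  - by move=> p Gp; exists 0; rewrite !mulr0z !addr0; case: p Gp.
  - by exists (-1); rewrite /= !mulrN1z !subrr; exact: functional0 gG.
have [||n Kn] := @int_subgroup_principal (fun k => exists d, G (m *~ k, d)).
- by exists 0; exact: functional0 gG.
- move=> k l [d Gd] [d' Gd']; exists (d - d').
  by rewrite mulrzBr; exact: (functionalB gG Gd Gd').
have [d Gd] : exists d, G (m *~ n%:Z, d) by apply/Kn; exists 1; rewrite mul1r.
have [e ed] : exists e, e *+ n = d.
  (* If [n = 0], then [d = 0] and any [e] would do. *)
  case: n {Kn} Gd => [|n] Gd; last exact: D_divisible.
  by exists 0; rewrite (functional_eq0 gG Gd).
exists e => k d' Gd'; have [q kE] := (Kn k).1 (ex_intro _ _ Gd').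
apply: (functional_det gG Gd'); rewrite kE mulrC !mulrzA -!pmulrn ed.
have -> : (m *+ n *~ q, d *~ q) = (m *+ n, d) *~ q.
  rewrite [RHS]surjective_pairing; congr (_, _); apply/esym.
    exact: (raddfMz (@fst M D)).
  exact: (raddfMz (@snd M D)).
exact: functionalMz gG Gd.
Qed.

(** A maximal graph is defined everywhere, as adjoining a point cannot enlarge it. *)
Lemma additive_extension G : functional_subgroup G ->
  exists f : M -> D, zmod_morphism f /\ forall p, G p -> f p.1 = p.2.
Proof.
move=> /functional_subgroup_maximal[H [gH sGH maxH]].
have /choice[f Hf] : forall m, exists d, H (m, d).
  move=> m; have [K [d [gK sHK Km]]] := functional_subgroup_adjoin m gH.
  by exists d; apply: maxH Km.
exists f; split=> [x y|[m d] /sGH Hm].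
  exact: functional_det gH (Hf _) (functionalB gH (Hf x) (Hf y)).
exact: functional_det gH (Hf _) Hm.
Qed.

End AdditiveExtension.

(** * The group Q/Z *)

Definition rat_int : {pred rat} := fun x => x \is a Num.int.

Fact rat_int_closed : zmod_closed rat_int.
Proof.
by split=> [|x y xZ yZ]; rewrite -topredE /= /rat_int ?rpred0 ?rpredB.
Qed.

HB.instance Definition _ := GRing.isZmodClosed.Build rat rat_int rat_int_closed.

Definition rat_mod_int : Type := Quotient.quot rat_int.

HB.instance Definition _ := GRing.Zmodule.on rat_mod_int.

Definition rat_class (x : rat) : rat_mod_int :=
  (\pi_(Quotient.quot rat_int) x)%qT.

Fact rat_class_is_zmod_morphism : zmod_morphism rat_class.
Proof. exact: (raddfB \pi_(Quotient.quot rat_int)%qT). Qed.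

HB.instance Definition _ := GRing.isZmodMorphism.Build rat rat_mod_int rat_class
  rat_class_is_zmod_morphism.

Lemma rat_class_eq0 x : (rat_class x == 0) = (x \is a Num.int).
Proof.
by rewrite -[0](raddf0 rat_class) /rat_class -[LHS]Quotient.idealrBE subr0.
Qed.

Lemma rat_mod_int_divisible : divisible rat_mod_int.
Proof.
move=> n d; exists (rat_class (repr (d : Quotient.quot rat_int) / n.+1%:R)).
rewrite -(raddfMn rat_class) /= -[X in rat_class X]mulr_natr.
rewrite divfK ?pnatr_eq0 //.
exact: reprK.
Qed.

Lemma rat_mod_int_torsion n :
  n != 1%N -> exists e : rat_mod_int, e != 0 /\ e *+ n = 0.
Proof.
(* The witness is the class of 1/k. For [n = 0] every element satisfies the equation, so 2 is just
   some integer above 1. *)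
move=> n_neq1; pose k := if n is 0 then 2%N else n.
have k_gt1 : (1 < k)%N by case: n @k n_neq1 => [|[]].
have k_gt0 := ltnW k_gt1.
exists (rat_class k%:R^-1); split.
  rewrite rat_class_eq0; apply/negP => /norm_intr_ge1.
  rewrite invr_eq0 pnatr_eq0 -lt0n k_gt0 => /(_ isT).
  by rewrite ger0_norm ?invr_ge0 ?ler0n // leNgt invf_lt1 ?ltr1n ?ltr0n ?k_gt1.
apply/eqP; rewrite -(raddfMn rat_class) /= rat_class_eq0.
rewrite -[X in X \is a _]mulr_natr.
by case: n {n_neq1 k_gt1} @k k_gt0 => [|n] k _;
  rewrite ?mulr0 ?mulVf ?rpred0 ?rpred1 ?pnatr_eq0.
Qed.

(** Let [n] generate the integers [k] with [k m] in [B]; it is not 1. Some nonzero [e] in Q/Z has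
    [n e = 0], so sending [B] to 0 and [m] to [e] is well defined on their sum (the graph [G]) and
    extends to [M]. *)
Lemma separating_additive (M : zmodType) (B : set M) (m : M) :
  B 0 -> (forall x y, B x -> B y -> B (x - y)) -> ~ B m ->
  exists f : M -> rat_mod_int,
    [/\ zmod_morphism f, forall x, B x -> f x = 0 & f m <> 0].
Proof.
move=> B0 BB nBm.
have [||n Kn] := @int_subgroup_principal (fun k => B (m *~ k)).
- exact: B0.
- by move=> k l Bk Bl; rewrite mulrzBr; apply: BB.
have n1 : n != 1%N.
  by apply: contra_notN nBm => /eqP n1; apply/(Kn 1); exists 1; rewrite n1.
have [e [/eqP e_neq0 en0]] := rat_mod_int_torsion n1.
pose G (p : M * rat_mod_int) := exists k, B (p.1 - m *~ k) /\ p.2 = e *~ k.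
have gG : functional_subgroup G.
  split=> [|p q [k [Bp pE]] [l [Bq qE]]|d [k [/= Bk ->]]].
  - by exists 0; rewrite subr0.
  - exists (k - l); split; last by rewrite mulrzBr -pE -qE.
    by have := BB _ _ Bp Bq; rewrite mulrzBr !opprD !opprK addrACA.
  - have /Kn[q ->] : B (m *~ k).
      by have := BB _ _ B0 Bk; rewrite !sub0r !opprK.
    by rewrite mulrC mulrzA -pmulrn en0 mul0rz.
have [f [fB fG]] := additive_extension rat_mod_int_divisible gG.
exists f; split=> // [x Bx|].
  by apply: (fG (x, 0)); exists 0; rewrite mulr0z subr0.
by rewrite (fG (m, e)) //; exists 1; rewrite subrr.
Qed.

Definition mk_linear (R : pzRingType) (U V : lmodType R) (f : U -> V)
    (f_linear : linear f) : {linear U -> V} :=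
  HB.pack f (GRing.isLinear.Build R U V *:%R f f_linear).

Section LinearFactorization.
Variables (R : pzRingType) (U V W : lmodType R).

Lemma linear_factor_surj (g : {linear U -> V}) (f : {linear U -> W}) :
  surjective g -> (forall x, g x = 0 -> f x = 0) ->
  exists h : {linear V -> W}, forall x, h (g x) = f x.
Proof.
move=> /choice[s gs] kerf.
have fs x : f (s (g x)) = f x.
  apply/eqP; rewrite -subr_eq0 -linearB; apply/eqP/kerf.
  by rewrite linearB gs subrr.
have lin : linear (f \o s).
  by move=> r x y /=; rewrite -linearP -[in RHS]fs linearP !gs.
by exists (mk_linear lin).
Qed.

Lemma linear_factor_inj (i : {linear U -> V}) (f : {linear W -> V}) :
  injective i -> (forall w, exists u, i u = f w) ->
  exists h : {linear W -> U}, forall w, i (h w) = f w.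
Proof.
move=> i_inj /choice[h ih].
have lin : linear h by move=> r x y; apply: i_inj; rewrite linearP !ih linearP.
by exists (mk_linear lin).
Qed.

End LinearFactorization.

Lemma zmod_morphismD (A B : zmodType) (f : A -> B) :
  zmod_morphism f -> {morph f : x y / x + y}.
Proof.
move=> fB; have f0 : f 0 = 0 by have := fB 0 0; rewrite !subrr.
by move=> x y; rewrite -{1}[y]opprK fB -[- y]sub0r fB f0 sub0r opprK.
Qed.

(** * The character module, an injective cogenerator *)

Section CharacterModule.
Variable R : pzRingType.

Definition is_char : {pred R -> rat_mod_int} := fun f => `[< zmod_morphism f >].

Fact is_char_closed : zmod_closed is_char.
Proof.
split=> [|f g /asboolP fB /asboolP gB]; apply/asboolP => x y.
  by rewrite subrr.
rewrite -[LHS]/(f (x - y) - g (x - y)) -[RHS]/(f x - g x - (f y - g y)).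
by rewrite fB gB !opprD addrACA.
Qed.

HB.instance Definition _ :=
  GRing.isZmodClosed.Build (R -> rat_mod_int) is_char is_char_closed.

(* Hom_Z(R, Q/Z), with the left action (r f)(x) = f (x r). *)
Record character : Type :=
  Character { char_fun :> R -> rat_mod_int; _ : char_fun \in is_char }.

HB.instance Definition _ := [isSub for char_fun].
HB.instance Definition _ := [Choice of character by <:].
HB.instance Definition _ := [SubChoice_isSubZmodule of character by <:].

Lemma charB (f : character) : zmod_morphism f.
Proof. by case: f => f /= /asboolP. Qed.

Lemma charD (f : character) : {morph f : x y / x + y}.
Proof. exact/zmod_morphismD/charB. Qed.

Lemma character_ext (f g : character) : f =1 g -> f = g.
Proof. by move=> fg; apply/val_inj/funext. Qed.

Fact char_scale_subproof (r : R) (f : character) :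
  (fun x => f (x * r)) \in is_char.
Proof. by apply/asboolP => x y; rewrite mulrBl charB. Qed.

Definition char_scale r f := Character (char_scale_subproof r f).

Fact char_scaleA a b f : char_scale a (char_scale b f) = char_scale (a * b) f.
Proof. by apply: character_ext => x /=; rewrite mulrA. Qed.
Fact char_scale1 : left_id 1 char_scale.
Proof. by move=> f; apply: character_ext => x /=; rewrite mulr1. Qed.
Fact char_scaleDr : right_distributive char_scale +%R.
Proof. by move=> r f g; apply: character_ext. Qed.
Fact char_scaleDl f : {morph char_scale^~ f : a b / a + b}.
Proof. by move=> a b; apply: character_ext => x /=; rewrite mulrDr charD. Qed.

HB.instance Definition _ := GRing.Zmodule_isLmodule.Build R character
  char_scaleA char_scale1 char_scaleDr char_scaleDl.

(** One direction of the bijection between Hom_Z(M, Q/Z) and Hom_R(M, Hom_Z(R, Q/Z)). *)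
Lemma char_of_additive (M : lmodType R) (h : M -> rat_mod_int) :
  zmod_morphism h ->
  exists g : {linear M -> character}, forall x r, g x r = h (r *: x).
Proof.
move=> hB.
have h_char x : (fun r => h (r *: x)) \in is_char.
  by apply/asboolP => r s; rewrite scalerBl hB.
have lin : linear (fun x => Character (h_char x)).
  move=> r x y; apply: character_ext => s.
  rewrite -[LHS]/(h (s *: (r *: x + y))).
  rewrite -[RHS]/(h ((s * r) *: x) + h (s *: y)) scalerDr scalerA.
  exact: zmod_morphismD.
by exists (mk_linear lin).
Qed.

(** A linear [f] is determined by the additive map sending [m] to [f m 1]; extend that map along [i]
    and take the adjoint of the extension. *)
Lemma character_injective : injective_module (character : lmodType R).
Proof.
move=> M N i f i_inj.
pose G (p : N * rat_mod_int) := exists m, i m = p.1 /\ f m 1 = p.2.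
have gG : functional_subgroup G.
  split=> [|p q [m [im fm]] [n [jn fn]]|d [m [/= im fm]]].
  - by exists 0; rewrite !raddf0.
  - exists (m - n); split; first by rewrite linearB im jn.
    by rewrite linearB -[RHS]/(p.2 - q.2) -fm -fn.
  - by rewrite -fm (i_inj m 0) ?raddf0.
have [h [hB hG]] := additive_extension rat_mod_int_divisible gG.
have [g gE] := char_of_additive hB.
exists g => m /=; apply: character_ext => r; rewrite gE -linearZ.
transitivity (f (r *: m) 1).
  by apply: (hG (i (r *: m), f (r *: m) 1)); exists (r *: m).
by rewrite linearZ -[LHS]/(f m (1 * r)) mul1r.
Qed.

(** Separate [m] from the image of [i] by an additive map to Q/Z. Its adjoint still kills the image,
    which is stable under scaling, and at [m] it takes a nonzero value on 1. *)
Lemma character_separates (L M : lmodType R) (i : {linear L -> M}) (m : M) :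
  ~ (exists l, i l = m) ->
  exists q : {linear M -> character}, (forall l, q (i l) = 0) /\ q m <> 0.
Proof.
move=> nm.
have [|x y [l <-] [l' <-]|h [hB h0 hm]] :=
    @separating_additive M (fun x => exists l, i l = x) m _ _ nm.
- by exists 0; rewrite raddf0.
- by exists (l - l'); rewrite linearB.
have [q qE] := char_of_additive hB; exists q; split=> [l|qm0].
  by apply: character_ext => r; rewrite qE -linearZ h0 //; exists (r *: l).
by apply: hm; rewrite -[m]scale1r -qE qm0.
Qed.

End CharacterModule.

Section Product.
Variables (R : pzRingType) (J : Type) (W : J -> lmodType R).

Lemma dprod_coord_is_linear j : linear (fun x : dprod W => x j).
Proof. by []. Qed.

Lemma dprod_tuple (M : lmodType R) (f : forall j, {linear M -> W j}) :
  exists g : {linear M -> dprod W}, forall x j, g x j = f j x.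
Proof.
have lin : linear (fun x => (fun j => f j x) : dprod W).
  by move=> r x y; apply: dprod_ext => j; rewrite linearP.
by exists (mk_linear lin).
Qed.

Lemma dprod_injective :
  (forall j, injective_module (W j)) -> injective_module (dprod W : lmodType R).
Proof.
move=> W_inj M N i f i_inj.
have exg j : exists g : {linear N -> W j}, forall m, g (i m) = f m j.
  exact: (W_inj j M N i
    (mk_linear (@dprod_coord_is_linear j) \o f : {linear _ -> _})).
pose g j := sval (cid (exg j)).
have gf j m : g j (i m) = f m j by rewrite /g; case: cid.
have [h hE] := dprod_tuple g; exists h => m /=.
by apply: dprod_ext => j; rewrite hE gf.
Qed.

End Product.

(** This embeds the cokernel of [i] in an injective module without forming the quotient: [I] has one
    factor [character R] for each map that kills the image of [i]. *)
Lemma injective_quotient_embedding (R : pzRingType) (L M : lmodType R)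
    (i : {linear L -> M}) :
  exists (I : lmodType R) (q : {linear M -> I}),
    injective_module I /\ forall m, q m = 0 <-> exists l, i l = m.
Proof.
pose J := {q : {linear M -> character R} | forall l, q (i l) = 0}.
have [q qE] := @dprod_tuple R J (fun=> character R) M (fun j => sval j).
exists (dprod (fun _ : J => character R)), q; split.
  by apply: dprod_injective => _; apply: character_injective.
move=> m; split=> [qm0|[l <-]]; last first.
  by apply: dprod_ext => j; rewrite qE; case: j.
apply: contrapT => /character_separates[p [pi0 pm]].
by apply: pm; rewrite -(qE m (exist _ p pi0)) qm0.
Qed.

(** * Vanishing of Ext *)

Section ImageProjection.
Variables (R : pzRingType) (U V : lmodType R) (f : {linear U -> V}).

Fact image_proj_subproof x : f x \in in_image f.
Proof. by apply/asboolP; exists x. Qed.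

Definition image_proj x : image_module f := ImageModule (image_proj_subproof x).

Fact image_proj_is_linear : linear image_proj.
Proof. by move=> r x y; apply: val_inj; rewrite /= linearP. Qed.

HB.instance Definition _ :=
  GRing.isLinear.Build R U (image_module f) _ image_proj image_proj_is_linear.

Lemma image_proj_surj : surjective image_proj.
Proof. by case=> y fy; have /asboolP[x fx] := fy; exists x; apply: val_inj. Qed.

Lemma image_proj_eq0 x : image_proj x = 0 <-> f x = 0.
Proof.
split=> [/(congr1 val)|fx0]; first by rewrite raddf0.
by apply: val_inj; rewrite raddf0.
Qed.

Definition image_incl : {linear image_module f -> V} := val.

Lemma image_incl_inj : injective image_incl.
Proof. exact: val_inj. Qed.

End ImageProjection.

Section ShortExact.
Variable R : pzRingType.

Record short_exact (X Y Z : lmodType R) (i : {linear X -> Y})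
    (p : {linear Y -> Z}) : Prop := {
  short_exact_inj : injective i;
  short_exact_surj : surjective p;
  short_exact_mid : forall y, p y = 0 <-> exists x, i x = y
}.

Lemma short_exact_comp0 (X Y Z : lmodType R) (i : {linear X -> Y})
    (p : {linear Y -> Z}) :
  short_exact i p -> forall x, p (i x) = 0.
Proof. by move=> ex x; apply/(short_exact_mid ex); exists x. Qed.

Lemma short_exact_factor (X Y Z : lmodType R) (i : {linear X -> Y})
    (p : {linear Y -> Z}) (W : lmodType R) (f : {linear W -> Y}) :
  short_exact i p -> (forall w, p (f w) = 0) ->
  exists g : {linear W -> X}, forall w, i (g w) = f w.
Proof.
move=> ex pf; apply: linear_factor_inj (short_exact_inj ex) _ => w.
exact/(short_exact_mid ex).
Qed.

Lemma injective_factor (I U V : lmodType R) (g : {linear U -> V})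
    (f : {linear U -> I}) :
  injective_module I -> (forall x, g x = 0 -> f x = 0) ->
  exists h : {linear V -> I}, forall x, h (g x) = f x.
Proof.
move=> I_inj kerf.
have [|f' f'E] :=
    @linear_factor_surj _ _ _ _ (image_proj g) f (@image_proj_surj _ _ _ g).
  by move=> x /image_proj_eq0/kerf.
have [h hE] := I_inj _ _ (image_incl g) f' (@image_incl_inj _ _ _ g).
by exists h => x; rewrite -f'E -hE.
Qed.

(** The cokernel of the zero map embeds [X] in [I]; the cokernel of this embedding is realised as
    the image of a map out of [I] with kernel [X]. *)
Lemma short_exact_injective (X : lmodType R) :
  exists (I X' : lmodType R) (i : {linear X -> I}) (p : {linear I -> X'}),
    injective_module I /\ short_exact i p.
Proof.
have [I [i [I_inj iE]]] := @injective_quotient_embedding R X X \0.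
have [I' [q [_ qE]]] := injective_quotient_embedding i.
exists I, (image_module q), i, (image_proj q); split=> //; split.
- move=> x y ixy; apply/eqP; rewrite -subr_eq0; apply/eqP.
  by have /iE[z <-] : i (x - y) = 0 by rewrite linearB ixy subrr.
- exact: image_proj_surj.
- by move=> y; rewrite image_proj_eq0.
Qed.

End ShortExact.

Section ExtAt.
Variable R : pzRingType.

(* Ext^(k+1)(M, X) = 0, computed on the resolution P. *)
Definition ext_at (M : lmodType R) (P : projective_resolution M) (k : nat)
    (X : lmodType R) :=
  forall f : {linear res_obj P k.+1 -> X},
    (forall x, f (res_d P k.+1 x) = 0) ->
    exists g : {linear res_obj P k -> X}, forall x, f x = g (res_d P k x).

Section Resolution.
Variables (M : lmodType R) (P : projective_resolution M).

Lemma res_dd k x : res_d P k (res_d P k.+1 x) = 0.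
Proof. by apply/res_exactS; exists x. Qed.

Lemma res_lift k (Y Z : lmodType R) (p : {linear Y -> Z})
    (f : {linear res_obj P k -> Z}) :
  surjective p -> exists g : {linear res_obj P k -> Y}, forall x, p (g x) = f x.
Proof. exact: (@res_projective _ _ P k Y Z p f). Qed.

Section Shift.
Variables (X Y Z : lmodType R) (i : {linear X -> Y}) (p : {linear Y -> Z}).
Hypothesis ex : short_exact i p.

(** The stretch Ext^(k+1)(M, Z) -> Ext^(k+2)(M, X) -> Ext^(k+2)(M, Y) of the long exact sequence,
    chased on cochains. *)
Lemma ext_atS k : ext_at P k.+1 Y -> ext_at P k Z -> ext_at P k.+1 X.
Proof.
move=> extY extZ u ud.
have [|h hE] := extY (i \o u : {linear _ -> _}).
  by move=> x /=; rewrite ud raddf0.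
have [|w wE] := extZ (p \o h : {linear _ -> _}).
  by move=> x /=; rewrite -hE; apply: (short_exact_comp0 ex).
have [w' w'E] := res_lift w (short_exact_surj ex).
have [|v vE] :=
    short_exact_factor (f := (h \- (w' \o res_d P k) : {linear _ -> _})) ex.
  by move=> x /=; rewrite linearB w'E -wE subrr.
exists v => x; apply: (short_exact_inj ex).
by rewrite vE /= res_dd raddf0 subr0 -hE.
Qed.

(** The stretch Ext^(k+1)(M, Y) -> Ext^(k+1)(M, Z) -> Ext^(k+2)(M, X) of the long exact sequence. *)
Lemma ext_at_pred k : ext_at P k Y -> ext_at P k.+1 X -> ext_at P k Z.
Proof.
move=> extY extX f fd.
have [f' f'E] := res_lift f (short_exact_surj ex).
have [|u uE] :=
    short_exact_factor (f := (f' \o res_d P k.+1 : {linear _ -> _})) ex.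
  by move=> x /=; rewrite f'E.
have [|v vE] := extX u.
  move=> x; apply: (short_exact_inj ex).
  by rewrite uE /= res_dd !raddf0.
have [|w wE] := extY (f' \- (i \o v) : {linear _ -> _}).
  by move=> x /=; rewrite -vE uE /= subrr.
exists (p \o w : {linear _ -> _}) => x /=.
by rewrite -wE linearB f'E /= (short_exact_comp0 ex) subr0.
Qed.

End Shift.

Lemma ext_at_injective k (I : lmodType R) : injective_module I -> ext_at P k I.
Proof.
move=> I_inj f fd.
have [|h hE] := injective_factor (g := res_d P k) (f := f) I_inj.
  by move=> x /res_exactS[y <-].
by exists h.
Qed.

(** Treats the k-th syzygy uniformly, although it is defined by the augmentation for [k = 0] and by
    a differential otherwise. *)
Lemma res_image_proj k : exists g : {linear res_obj P k -> res_image P k},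
  surjective g /\ forall x, g x = 0 <-> exists y, res_d P k y = x.
Proof.
case: k => [|k].
  exists (image_proj (res_aug P)); split; first exact: image_proj_surj.
  by move=> x; rewrite image_proj_eq0 res_exact0.
exists (image_proj (res_d P k)); split; first exact: image_proj_surj.
by move=> x; rewrite image_proj_eq0 res_exactS.
Qed.

End Resolution.

Definition lifts (Y Z : lmodType R) (p : {linear Y -> Z}) (M : lmodType R) :=
  forall f : {linear M -> Z},
    exists h : {linear M -> Y}, forall x, p (h x) = f x.

(* As [res_image P k] is the k-th syzygy, this is the end of the long exact
   sequence Hom(M_k, Y) -> Hom(M_k, Z) -> Ext^1(M_k, X) -> Ext^1(M_k, Y). *)
Lemma ext_at_lifts (X Y Z : lmodType R) (i : {linear X -> Y})
    (p : {linear Y -> Z}) (M : lmodType R) (P : projective_resolution M) k :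
  short_exact i p -> ext_at P k Y ->
  ext_at P k X <-> lifts p (res_image P k).
Proof.
move=> ex extY.
have [g [g_surj g0]] := res_image_proj P k.
have gd x : g (res_d P k x) = 0 by apply/g0; exists x.
split=> [ext f|lift u ud].
  have [h hE] := res_lift (f \o g : {linear _ -> _}) (short_exact_surj ex).
  have [|u uE] :=
      short_exact_factor (f := (h \o res_d P k : {linear _ -> _})) ex.
    by move=> x; rewrite /= hE /= gd raddf0.
  have [|v vE] := ext u.
    move=> x; apply: (short_exact_inj ex).
    by rewrite uE /= res_dd !raddf0.
  have [|w wE] :=
      linear_factor_surj (g := g) (f := (h \- (i \o v) : {linear _ -> _}))
        g_surj.
    by move=> _ /g0[x <-] /=; rewrite -vE uE /= subrr.
  exists w => y; have [x <-] := g_surj y.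
  by rewrite wE /= linearB hE /= (short_exact_comp0 ex) subr0.
have [|h hE] := extY (i \o u : {linear _ -> _}).
  by move=> x /=; rewrite ud raddf0.
have [|f fE] :=
    linear_factor_surj (g := g) (f := (p \o h : {linear _ -> _})) g_surj.
  by move=> _ /g0[x <-] /=; rewrite -hE; apply: (short_exact_comp0 ex).
have [w wE] := lift f.
have [|v vE] := short_exact_factor (f := (h \- (w \o g) : {linear _ -> _})) ex.
  by move=> x /=; rewrite linearB wE fE /= subrr.
exists v => x; apply: (short_exact_inj ex).
by rewrite vE /= gd raddf0 subr0 -hE.
Qed.

Lemma linear_inverse (U V : lmodType R) (f : {linear U -> V}) :
  bijective f -> exists g : {linear V -> U}, cancel f g /\ cancel g f.
Proof.
case=> g fK gK.
have lin : linear g.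
  by move=> r x y; apply: (can_inj fK); rewrite linearP !gK.
by exists (mk_linear lin).
Qed.

Section LiftsClosure.
Variables (Y Z : lmodType R) (p : {linear Y -> Z}).

Lemma lifts_retract (M W : lmodType R) (j : {linear W -> M})
    (r : {linear M -> W}) :
  cancel j r -> lifts p M -> lifts p W.
Proof.
move=> jK lift f; have [h hE] := lift (f \o r : {linear _ -> _}).
by exists (h \o j : {linear _ -> _}) => x; rewrite /= hE /= jK.
Qed.

Lemma lifts_iso (M M' : lmodType R) :
  isomorphic M M' -> lifts p M' -> lifts p M.
Proof.
move=> [f /linear_inverse[g [fK gK]]]; exact: lifts_retract fK.
Qed.

Lemma lifts_summand (W M : lmodType R) :
  iso_to_summand W M -> lifts p M -> lifts p W.
Proof.
move=> [V [f /linear_inverse[g [fK gK]]]].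
have lin : linear (fun w : W => (w, 0 : V)).
  by move=> r x y; congr (_, _); rewrite /= scaler0 addr0.
apply: (@lifts_retract M W (g \o mk_linear lin : {linear _ -> _})
  (fst \o f : {linear _ -> _})) => w /=.
by rewrite gK.
Qed.

End LiftsClosure.

End ExtAt.

(** * Lifting maps out of a direct sum *)

Section DsumLift.
Variables (R : pzRingType) (J : Type) (W : J -> lmodType R).
Local Open Scope classical_set_scope.
(** Gives the arbitrary index type the equality test that [dfwith] and finite sums rely on. *)
Local Notation cJ := {classic J}.

Let supp (x : dsum W) : set cJ := [set j : cJ | dsum_val x j <> 0].

Let supp_fin x : finite_set (supp x).
Proof. by case: x => x xW; apply/asboolP. Qed.

Section Incl.
Variable j : J.

Let incl (w : W j) : dprod W :=
  @dfwith cJ W (fun k => (0 : W k)) j w.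

Let incl_in w : incl w \in @in_dsum R J W.
Proof.
apply/asboolP; apply: (@sub_finite_set _ _ [set (j : cJ)]) => // k /= nk.
by apply/esym; apply: contrapT => /eqP jk; apply: nk; exact: (@dfwithout cJ).
Qed.

Lemma dsum_incl_exists : exists e : {linear W j -> dsum W},
  (forall w, dsum_val (e w) j = w) /\
  (forall w k, k <> j -> dsum_val (e w) k = 0).
Proof.
have in_j w : incl w j = w by exact: (@dfwithin cJ).
have out_j w k : k <> j -> incl w k = 0.
  by move=> kj; apply: (@dfwithout cJ); apply/eqP => /esym.
have lin : linear (fun w => DSum (incl_in w)).
  move=> r x y; apply: val_inj; apply: dprod_ext => k.
  rewrite -[RHS]/(r *: incl x k + incl y k) -[LHS]/(incl (r *: x + y) k).
  have [->|kj] := pselect (k = j); first by rewrite !in_j.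
  by rewrite !out_j // scaler0 addr0.
exists (mk_linear lin); split=> w; [exact: in_j | exact: out_j].
Qed.

End Incl.

Let e j := sval (cid (dsum_incl_exists j)).
Let e_in j w : dsum_val (e j w) j = w.
Proof. by rewrite /e; case: cid => ? []. Qed.
Let e_out j w k : k <> j -> dsum_val (e j w) k = 0.
Proof. by rewrite /e; case: cid => ? [] /= _ H /H. Qed.

Let dsum_expand x : x = \sum_(j \in supp x) e j (dsum_val x j).
Proof.
apply: val_inj; apply: dprod_ext => k.
rewrite fsbig_finite //=.
have -> (s : seq cJ) (F : cJ -> dsum W) :
    dsum_val (\sum_(i <- s) F i) k = \sum_(i <- s) dsum_val (F i) k.
  by elim/big_ind2: _ => // a b c d <- <-.
have U := fset_uniq (fset_set (supp x)).
have [ks|ks] := boolP ((k : cJ) \in fset_set (supp x)).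
  rewrite (bigD1_seq (k : cJ)) //= e_in big1 ?addr0 // => i ik.
  by rewrite e_out // => ki; rewrite ki eqxx in ik.
rewrite big_seq big1 => [|i si].
  move: ks; rewrite in_fset_set // => /negP; rewrite inE => nk.
  exact: contrapT.
by rewrite e_out // => ki; rewrite ki si in ks.
Qed.

Section Lift.
Variables (M : lmodType R) (h : forall j, {linear W j -> M}).

Let lift (x : dsum W) : M := \sum_(j \in [set: cJ]) h j (dsum_val x j).

Let liftE (A : set cJ) x : finite_set A -> supp x `<=` A ->
  lift x = \sum_(j \in A) h j (dsum_val x j).
Proof.
move=> fA sA; apply/esym/fsbig_widen => // j [_ /= nA].
rewrite (_ : dsum_val x j = 0) ?raddf0 //.
by apply: contrapT => xj; apply/nA/sA.
Qed.

Let lift_is_linear : linear lift.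
Proof.
move=> r x y.
have fA : finite_set (supp x `|` supp y) by rewrite finite_setU.
rewrite !(liftE fA); first last.
- move=> j; rewrite /supp /= => xj.
  have [xj0|] := pselect (dsum_val x j = 0); last by left.
  right=> yj0; apply: xj; rewrite -[LHS]/(r *: dsum_val x j + dsum_val y j).
  by rewrite xj0 yj0 scaler0 addr0.
- by move=> j; left.
- by move=> j; right.
rewrite !fsbig_finite //= scaler_sumr -big_split /=.
by apply: eq_bigr => j _; rewrite -linearP.
Qed.

Let lift_e j w : lift (e j w) = h j w.
Proof.
rewrite (@liftE [set j]) //.
  by rewrite fsbig_set1 e_in.
by move=> k /= nk; apply: contrapT => kj; apply: nk; exact: e_out.
Qed.

Lemma dsum_lift_exists :
  exists g : {linear dsum W -> M}, forall j w, g (e j w) = h j w.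
Proof. by exists (mk_linear lift_is_linear). Qed.

End Lift.

Lemma lifts_dsum (Y Z : lmodType R) (p : {linear Y -> Z}) :
  (forall j, lifts p (W j)) -> lifts p (dsum W : lmodType R).
Proof.
move=> lift f; have exh j := lift j (f \o e j : {linear _ -> _}).
pose h j := sval (cid (exh j)).
have hE j w : p (h j w) = f (e j w) by rewrite /h; case: cid => ?; apply.
have [g gE] := dsum_lift_exists h; exists g => x.
rewrite [x]dsum_expand fsbig_finite // !linear_sum.
by apply: eq_bigr => j _; rewrite gE hE.
Qed.

End DsumLift.

(** * Independence of the resolution and ultimately closed resolutions *)

Section ExtVanishing.
Variables (R : pzRingType) (M : lmodType R).

Lemma res_image0_iso (P : projective_resolution M) :
  isomorphic (res_image P 0) M /\ isomorphic M (res_image P 0).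
Proof.
have bij : bijective (image_incl (res_aug P)).
  have /choice[s sE] : forall x, exists y, res_aug P y = x.
    exact: res_aug_surj.
  exists (fun x => image_proj (res_aug P) (s x)) => [y|x]; last exact: sE.
  by apply: val_inj; apply: sE.
split; first by exists (image_incl (res_aug P)).
have [g [gK Kg]] := linear_inverse bij.
by exists g; exists (image_incl (res_aug P)).
Qed.

(** The right-hand side does not mention [P], which makes the vanishing of Ext^1 independent of the
    resolution. *)
Lemma ext_at0_lifts (P : projective_resolution M) (X Y Z : lmodType R)
    (i : {linear X -> Y}) (p : {linear Y -> Z}) :
  short_exact i p -> ext_at P 0 Y -> ext_at P 0 X <-> lifts p M.
Proof.
move=> ex extY; have [iso1 iso2] := res_image0_iso P.
split=> [/(ext_at_lifts ex extY)|lift]; first exact: lifts_iso.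
by apply/(ext_at_lifts ex extY); apply: lifts_iso lift.
Qed.

(** Degree 1 is a lifting property of [M]; higher degrees reduce to it by embedding [X] in an
    injective module. No chain map between the resolutions is built. *)
Lemma ext_at_indep (P P' : projective_resolution M) k X :
  ext_at P k X -> ext_at P' k X.
Proof.
elim: k X => [|k IHk] X;
  have [I [Z [i [p [I_inj ex]]]]] := short_exact_injective X.
  have extI P1 : ext_at P1 0 I := @ext_at_injective R M P1 0 I I_inj.
  move=> /(ext_at0_lifts ex (extI P)) lift.
  exact/(ext_at0_lifts ex (extI P')).
move=> ext; apply: (ext_atS ex); first exact: ext_at_injective.
apply: IHk; apply: (ext_at_pred ex) ext; exact: ext_at_injective.
Qed.

Lemma Ext_vanishesS (P : projective_resolution M) k X :
  Ext_vanishes k.+1 M X <-> ext_at P k X.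
Proof. by split=> [|ext P']; [apply | apply: ext_at_indep ext]. Qed.

(* Injective dimension shifting reduces to k = 0, where vanishing of Ext^1
   on the syzygies is a lifting property. *)
Lemma ultimately_closed_ext n : ultimately_closed_at M n ->
  exists P : projective_resolution M, forall X k,
    (forall i, (i < n)%N -> ext_at P (k + i) X) -> ext_at P (k + n) X.
Proof.
move=> [P [J [W [isoW Wsummand]]]]; exists P => X k.
elim: k X => [|k IHk] X ext;
  have [I [Z [i [p [I_inj ex]]]]] := short_exact_injective X.
  have extI l : ext_at P l I := @ext_at_injective R M P l I I_inj.
  apply/(ext_at_lifts ex (extI _)); apply: lifts_iso isoW _.
  apply: lifts_dsum => j; have [l [ln sW]] := Wsummand j.
  by apply: lifts_summand sW _; apply/(ext_at_lifts ex (extI l))/ext.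
rewrite addSn; apply: (ext_atS ex); first exact: ext_at_injective.
apply: IHk => l ln; apply: (ext_at_pred ex); first exact: ext_at_injective.
by rewrite -addSn; apply: ext.
Qed.

Lemma ultimately_closed_ext_all n (P : projective_resolution M) X :
  ultimately_closed_at M n -> (forall k, (k < n)%N -> ext_at P k X) ->
  forall k, ext_at P k X.
Proof.
move=> /ultimately_closed_ext[P' ucP] ext k; elim/ltn_ind: k => k IHk.
have [|nk] := ltnP k n; first exact: ext.
(* On the ultimately closed resolution [P'], degree index [k] follows from the [n] indices just
   below it. *)
apply: (@ext_at_indep P'); rewrite -(subnK nk); apply: ucP => i i_n.
apply: (@ext_at_indep P); apply: IHk.
by rewrite -[X in (_ < X)%N](subnK nk) ltn_add2l.
Qed.

End ExtVanishing.

(** * The functor C (x) - *)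

Section TensorFunctor.
Variables (R S : pzRingType) (C : bimodType R S).

(** Retypes [tens] so that the left R-action on [tensorC C N] is found. *)
Definition ten (N : lmodType S) (c : C) (n : N) : tensorC C N :=
  tens (c : right_module C) n.

Lemma tensorC_ind (N : lmodType S) (P : tensorC C N -> Prop) :
  P 0 -> (forall x y, P x -> P y -> P (x - y)) ->
  (forall c n, P (ten c n)) -> forall t, P t.
Proof. exact: tensor_ind. Qed.

Lemma tensorC_ext (N : lmodType S) (M : zmodType)
    (f g : {additive tensorC C N -> M}) :
  (forall c n, f (ten c n) = g (ten c n)) -> f =1 g.
Proof.
move=> fg; elim/tensorC_ind => [|x y fgx fgy|c n]; last exact: fg.
  by rewrite !raddf0.
by rewrite !raddfB fgx fgy.
Qed.

Lemma scale_ten (N : lmodType S) (r : R) c (n : N) :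
  r *: ten c n = ten (r *: c) n.
Proof. exact: tensorC_scaleE. Qed.

Lemma ten_linear (N : lmodType S) (n : N) : linear (fun c => ten c n).
Proof. exact: (mu_fun_is_linear n). Qed.

Lemma ten0l (N : lmodType S) (n : N) : ten 0 n = 0.
Proof. exact: (linear0 (mk_linear (ten_linear n))). Qed.

Lemma tenBl (N : lmodType S) (n : N) : {morph (fun c => ten c n) : c d / c - d}.
Proof. exact: (linearB (mk_linear (ten_linear n))). Qed.

Lemma ten0r (N : lmodType S) c : ten c (0 : N) = 0.
Proof.
by apply: (addrI (ten c (0 : N))); rewrite -[LHS]tensDr !addr0.
Qed.

Lemma tenBr (N : lmodType S) c (x y : N) : ten c (x - y) = ten c x - ten c y.
Proof. by apply: (canRL (addrK _)); rewrite -[LHS]tensDr subrK. Qed.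

Lemma ten_rscale (N : lmodType S) c (s : S) (n : N) :
  ten (rscale c s) n = ten c (s *: n).
Proof. exact: tensM. Qed.

Lemma tensorC_linear (N : lmodType S) (M : lmodType R)
    (f : {additive tensorC C N -> M}) :
  (forall r c n, f (ten (r *: c) n) = r *: f (ten c n)) -> linear f.
Proof.
move=> fZ r x y; rewrite raddfD; congr (_ + _).
elim/tensorC_ind: x => [|u v fu fv|c n].
- by rewrite scaler0 raddf0 scaler0.
- have fB a b : f (a - b) = f a - f b := raddfB f a b.
  by rewrite (@scalerBr R (tensorC C N) r u v) fB fu fv fB scalerBr.
- by rewrite scale_ten fZ.
Qed.

Section Map.
Variables (N N' : lmodType S) (g : {linear N -> N'}).

Definition tensorC_map : tensorC C N -> tensorC C N' :=
  tensor_map (idfun : {linear right_module C -> right_module C}) g.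

HB.instance Definition _ := GRing.isZmodMorphism.Build _ _ tensorC_map
  (raddfB (tensor_map (idfun : {linear right_module C -> right_module C}) g)).

Lemma tensorC_mapE c n : tensorC_map (ten c n) = ten c (g n).
Proof. exact: tensor_mapE. Qed.

Fact tensorC_map_is_scalable : scalable tensorC_map.
Proof.
move=> r x; have lin : linear tensorC_map.
  by apply: tensorC_linear => s c n /=; rewrite !tensorC_mapE scale_ten.
by have := lin r x 0; rewrite !addr0 raddf0 addr0.
Qed.

HB.instance Definition _ := GRing.isScalable.Build R _ _ _ tensorC_map
  tensorC_map_is_scalable.

End Map.

(** * The adjunction between C (x) - and Hom_R(C, -) *)

Section Adjunction.
Variables (N : lmodType S) (M : lmodType R).

Lemma tensorC_lift (f : {linear N -> homC C M}) :
  exists q : {linear tensorC C N -> M}, forall c n, q (ten c n) = f n c.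
Proof.
pose b (c : right_module C) (n : N) : M := f n c.
have bDl c c' n : b (c + c') n = b c n + b c' n by rewrite /b linearD.
have bDr c n n' : b c (n + n') = b c n + b c n' by rewrite /b linearD.
have bM c (s : S) n : b ((s : S^c) *: c) n = b c (s *: n).
  by rewrite /b linearZ.
pose q : tensorC C N -> M := tensor_lift b.
pose qa : {additive tensorC C N -> M} := HB.pack q
  (GRing.isZmodMorphism.Build _ _ q (tensor_lift_is_zmod_morphism bDl bDr bM)).
have qE c n : qa (ten c n) = f n c by exact: tensor_liftE bDl bDr bM _ _.
have lin : linear qa.
  by apply: tensorC_linear => r c n; rewrite !qE linearZ.
by exists (mk_linear lin).
Qed.

Lemma tensorC_curry (q : {linear tensorC C N -> M}) :
  exists f : {linear N -> homC C M}, forall n c, f n c = q (ten c n).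
Proof.
have lin_c n : linear (fun c => q (ten c n)).
  by move=> r c d; rewrite /ten tensDl linearD -/(ten _ _) -scale_ten linearZ.
have lin : linear (fun n => mk_linear (lin_c n) : homC C M).
  move=> s n n'; apply: linear_ext => c /=.
  by rewrite /ten tensDr linearD -tensM.
by exists (mk_linear lin).
Qed.

End Adjunction.

Section RightExact.
Variables (K N L : lmodType S) (d : {linear K -> N}) (p : {linear N -> L}).
Hypotheses (p_surj : surjective p)
  (exact_d : forall x, p x = 0 <-> exists y, d y = x).

Lemma tensorC_map_surj : surjective (tensorC_map p).
Proof.
elim/tensorC_ind => [|_ _ [x <-] [y <-]|c l].
- by exists 0; rewrite raddf0.
- by exists (x - y); rewrite raddfB.
- by have [n <-] := p_surj l; exists (ten c n); apply: tensorC_mapE.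
Qed.

(** If [t] were not in the image of C (x) d, a map [q] to the character module would kill that image
    but not [t]. Its adjoint kills the image of [d], so it factors through [p]; hence [q] factors
    through C (x) p and kills [t]. *)
Lemma tensorC_right_exact t :
  tensorC_map p t = 0 <-> exists u, tensorC_map d u = t.
Proof.
split=> [pt0|[u <-]]; last first.
  apply: (@tensorC_ext K _ (tensorC_map p \o tensorC_map d) \0) => c n /=.
  rewrite !tensorC_mapE; have -> : p (d n) = 0 by apply/exact_d; exists n.
  exact: ten0r.
apply: contrapT => /character_separates[q [q0 qt]]; apply: qt.
have [f fE] := tensorC_curry q.
have [|h hE] := linear_factor_surj (g := p) (f := f) p_surj.
  move=> x /exact_d[y <-]; apply: linear_ext => c.
  by rewrite fE -tensorC_mapE q0.
have [q' q'E] := tensorC_lift h.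
suff -> : q t = q' (tensorC_map p t) by rewrite pt0 raddf0.
apply: (@tensorC_ext N _ q (q' \o tensorC_map p)) => c n /=.
by rewrite tensorC_mapE q'E hE fE.
Qed.

End RightExact.

End TensorFunctor.

Arguments tensorC_map {R S} C {N N'} g t.

(** * C (x) Q for projective Q *)

Section DualBasis.
Variables (R S : pzRingType) (C : bimodType R S) (Q : lmodType S).

(** The coordinates of a section of the free module on the set [Q]. Allowing every duplicate-free
    [J] that contains [s] lets several expansions be compared over one list. *)
Lemma dual_basis : projective Q ->
  exists phi : Q -> {linear Q -> S^o}, forall q, exists s : seq Q,
    forall J, uniq J -> {subset s <= J} ->
      q = \sum_(y <- J) (phi y q : S) *: (y : Q).
Proof.
move=> Q_proj; pose eps : {linear free_module S Q -> Q} := free_lift id.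
have [|sec secK] := Q_proj _ _ eps (idfun : {linear Q -> Q}).
  by move=> q; exists (free_gen S q); apply: free_lift1.
have lin y : linear (fun q => free_coef (sec q) y : S^o).
  by move=> r x z; rewrite linearP.
exists (fun y => mk_linear (lin y)) => q.
have fA := free_supp_fin (sec q).
exists (fset_set (free_supp (sec q))) => J uJ sJ.
have fJ : finite_set [set` J]%classic by exact: finite_seq.
rewrite -{1}[q]secK /= /eps /=.
rewrite (@free_liftE S Q Q id _ _ fJ); last first.
  by move=> y qy /=; apply: sJ; rewrite in_fset_set ?inE.
by rewrite [RHS]fsbig_seq.
Qed.

(** This is C (x) phi followed by the identification of C (x) S with C. *)
Lemma tensorC_coord (phi : {linear Q -> S^o}) :
  exists f : {linear tensorC C Q -> C},
    forall c q, f (ten c q) = rscale c (phi q).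
Proof.
have lin : linear (fun q => right_homothety C (phi q) : homC C C).
  move=> s x y; apply: linear_ext => c /=.
  rewrite /rhom_fun linearP rscalerDr; congr (_ + _).
  by rewrite rscalerA.
by have [f fE] := tensorC_lift (mk_linear lin); exists f.
Qed.

Lemma ten_sumr (J : seq Q) (F : Q -> Q) c :
  ten c (\sum_(y <- J) F y) = \sum_(y <- J) (ten c (F y) : tensorC C Q).
Proof.
by apply: (big_morph (ten c)) => [x y|]; [exact: tensDr | exact: ten0r].
Qed.

(** The expansion of [t] plays the role of embedding C (x) Q as a summand in a direct sum of copies
    of C. *)
Lemma tensorC_dual_basis : projective Q ->
  exists (phi : Q -> {linear Q -> S^o}) (Phi : Q -> {linear tensorC C Q -> C}),
  [/\ forall y c q, Phi y (ten c q) = rscale c (phi y q),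
      forall q, exists s : seq Q, forall J, uniq J -> {subset s <= J} ->
        q = \sum_(y <- J) (phi y q : S) *: (y : Q)
    & forall t, exists s : seq Q, forall J, uniq J -> {subset s <= J} ->
        t = \sum_(y <- J) ten (Phi y t) y].
Proof.
move=> /dual_basis[phi phiE]; have exPhi y := tensorC_coord (phi y).
exists phi, (fun y => sval (cid (exPhi y))).
have PhiE y c q : sval (cid (exPhi y)) (ten c q) = rscale c (phi y q).
  by case: cid.
split=> //; elim/tensorC_ind => [|t u [s sE] [s' s'E]|c q].
- by exists nil => J _ _; rewrite big1 // => y _; rewrite raddf0 ten0l.
- exists (s ++ s') => J uJ sJ.
  rewrite [in LHS](sE J) // => [|y sy]; last by apply: sJ; rewrite mem_cat sy.
  rewrite [in LHS](s'E J) // => [|y sy]; last first.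
    by apply: sJ; rewrite mem_cat sy orbT.
  rewrite -sumrB; apply: eq_bigr => y _.
  by rewrite (linearB (sval (cid (exPhi y)))) tenBl.
- have [s sE] := phiE q; exists s => J uJ sJ.
  rewrite {1}(sE J uJ sJ) ten_sumr; apply: eq_bigr => y _.
  by rewrite PhiE ten_rscale.
Qed.

End DualBasis.

Section TensorProjective.
Variables (R S : pzRingType) (C : bimodType R S) (Q : lmodType S).
Hypotheses (C_semidualizing : semidualizing C) (Q_projective : projective Q).

(** One finite list serves all generators at once, so by linearity it serves all of [M]. *)
Lemma finitely_generated_factor (M : lmodType R) (f : {linear M -> tensorC C Q})
    (Phi : Q -> {linear tensorC C Q -> C}) :
  (forall t, exists s : seq Q, forall J, uniq J -> {subset s <= J} ->
        t = \sum_(y <- J) ten (Phi y t) y) ->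
  finitely_generated M ->
  exists J : seq Q, forall m, f m = \sum_(y <- J) ten (Phi y (f m)) y.
Proof.
move=> PhiE [n [e eM]]; have /choice[s sE] i := PhiE (f (e i)).
pose J := undup (flatten [seq s i | i <- enum 'I_n]); exists J => m.
have lin : linear (fun m => \sum_(y <- J) ten (Phi y (f m)) y).
  move=> r x y; rewrite scaler_sumr -big_split; apply: eq_bigr => z _.
  by rewrite (linearP f) (linearP (Phi z)) ten_linear.
rewrite -[RHS]/(mk_linear lin m); have [a ->] := eM m.
rewrite (linear_sum f) (linear_sum (mk_linear lin)); apply: eq_bigr => i _.
rewrite (linearZZ f) (linearZZ (mk_linear lin)) /=; congr (_ *: _).
apply: sE; first exact: undup_uniq.
move=> y yi; rewrite mem_undup; apply/flattenP; exists (s i) => //.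
by apply: map_f; rewrite mem_enum.
Qed.

(** On a resolution by finitely generated modules a cocycle has finitely many relevant coordinates.
    Each is a cocycle with values in C, hence a coboundary by (c1), and the bounding maps are summed
    up again. *)
Lemma ext_at_tensorC_projective (P : projective_resolution (C : lmodType R)) k :
  ext_at P k (tensorC C Q).
Proof.
have [P' P'_fg] := semidualizing_a1 C_semidualizing.
apply: (ext_at_indep (P := P')) => f fd.
have [_ [Phi [_ _ PhiE]]] := tensorC_dual_basis C Q_projective.
have [J fE] := finitely_generated_factor f PhiE (P'_fg k.+1).
have /choice[g gE] y : exists g : {linear res_obj P' k -> C},
    forall x, Phi y (f x) = g (res_d P' k x).
  apply: (semidualizing_c1 C_semidualizing (ltn0Sn k) P'
    (Phi y \o f : {linear _ -> _})).
  by move=> x /=; rewrite fd raddf0.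
have lin : linear (fun x => \sum_(y <- J) ten (g y x) y).
  move=> r x y; rewrite scaler_sumr -big_split; apply: eq_bigr => z _.
  by rewrite (linearP (g z)) ten_linear.
exists (mk_linear lin) => x; rewrite [LHS]fE.
by apply: eq_bigr => y _; rewrite gE.
Qed.

(** By (b2) an endomorphism of C is right multiplication by a unique scalar. Injectivity: the
    coordinates of c |-> c (x) q are multiplications by the coordinates of [q]. Surjectivity: the
    coordinates of a map C -> C (x) Q are endomorphisms of C, and finitely many suffice. *)
Lemma mu_projective_bij : bijective (@mu R S C Q).
Proof.
have [phi [Phi [PhiT phiE PhiE]]] := tensorC_dual_basis C Q_projective.
have b2 := semidualizing_b2 C_semidualizing.
have mu_inj : injective (@mu R S C Q).
  move=> q q' mu_eq; have phi_eq y : phi y q = phi y q'.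
    apply: (bij_inj b2); apply: linear_ext => c /=; rewrite /rhom_fun.
    rewrite -!PhiT; congr (Phi y _).
    exact: (congr1 (fun f : {linear C -> tensorC C Q} => f c) mu_eq).
  have [s sE] := phiE q; have [s' s'E] := phiE q'.
  have uJ := undup_uniq (s ++ s').
  rewrite (sE _ uJ) => [|y sy]; last by rewrite mem_undup mem_cat sy.
  rewrite [RHS](s'E _ uJ) => [|y sy]; last by rewrite mem_undup mem_cat sy orbT.
  by apply: eq_bigr => y _; rewrite phi_eq.
have mu_surj (f : homC C (tensorC C Q)) : exists q, mu C q = f.
  have C_fg : finitely_generated (C : lmodType R).
    have [P P_fg] := semidualizing_a1 C_semidualizing.
    have [n [e eP]] := P_fg 0%N; exists n, (fun i => res_aug P (e i)) => c.
    have [x <-] := @res_aug_surj _ _ P c; have [a {1}->] := eP x.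
    by exists a; rewrite linear_sum; apply: eq_bigr => i _; rewrite linearZ.
  have [J fE] :=
      finitely_generated_factor (f : {linear C -> tensorC C Q}) PhiE C_fg.
  have [g _ gK] := b2.
  (* [g] reads off the scalar of each coordinate endomorphism of [f]. *)
  exists (\sum_(y <- J)
    g (Phi y \o (f : {linear C -> tensorC C Q}) : {linear _ -> _}) *: (y : Q)).
  apply: linear_ext => c /=; rewrite fE -[LHS]/(ten c _) ten_sumr.
  apply: eq_bigr => y _; rewrite -ten_rscale; congr (ten _ _).
  exact: (congr1 (fun h : {linear C -> C} => h c) (gK _)).
have [nu nuK] := choice mu_surj.
by exists nu => [q|f]; [apply: mu_inj | ]; rewrite nuK.
Qed.

End TensorProjective.

(** * Syzygies of C (x) Q *)

Section TensorSyzygies.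
Variables (R S : pzRingType) (C : bimodType R S) (N : lmodType S).
Hypotheses (C_semidualizing : semidualizing C) (N_top : C_top C N).
Variables (Q : projective_resolution N)
  (P : projective_resolution (C : lmodType R)).

Let T m : lmodType R := tensorC C (res_obj Q m).
Let D m : {linear T m.+1 -> T m} := tensorC_map C (res_d Q m).

Let D_ten m c x : D m (ten c x) = ten c (res_d Q m x).
Proof. exact: tensorC_mapE. Qed.

Definition tensor_syzygy (m : nat) : lmodType R :=
  if m is k.+1 then image_module (tensorC_map C (res_d Q k))
  else tensorC C N.
Local Notation X := tensor_syzygy.

Let incl m : {linear X m.+1 -> T m} := image_incl (D m).

Definition tensor_syzygy_proj (m : nat) : {linear T m -> X m} :=
  if m is k.+1 then image_proj (tensorC_map C (res_d Q k))
  else tensorC_map C (res_aug Q).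
Local Notation proj := tensor_syzygy_proj.

(** For [m = 0] this is right exactness of C (x) -; for positive [m], exactness in the middle is
    Tor_m(C, N) = 0. *)
Lemma tensor_syzygy_exact m : short_exact (incl m) (proj m).
Proof.
have image_incl_im y : (exists u, D m u = y) <-> exists x, incl m x = y.
  split=> [[u <-]|[x <-]]; first by exists (image_proj (D m) u).
  by have [u <-] := image_proj_surj x; exists u.
case: m image_incl_im => [|m] im.
  split; first exact: image_incl_inj.
    exact: tensorC_map_surj (@res_aug_surj _ _ Q).
  move=> y; rewrite -im.
  exact: (tensorC_right_exact (@res_aug_surj _ _ Q) (@res_exact0 _ _ Q) y).
split; [exact: image_incl_inj | exact: image_proj_surj |] => y.
rewrite -im image_proj_eq0; split=> [/(N_top (ltn0Sn m))[u ->]|[u <-]].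
  by exists u.
apply: (@tensorC_ext _ _ _ _ _ (D m \o D m.+1) \0) => c n.
rewrite -[LHS]/(D m (D m.+1 (ten c n))) !D_ten res_dd.
exact: ten0r.
Qed.

(* A map from C to the image of C (x) Q_(m+2) in C (x) Q_(m+1) is c |-> c (x) q
   for some q, as mu is bijective on projectives. Injectivity of mu at Q_m
   makes q a cycle, so q comes from Q_(m+2) and the map lifts. *)
Lemma ext_at0_tensor_syzygy m : ext_at P 0 (X m.+3).
Proof.
have extT j : ext_at P 0 (T j).
  by apply: ext_at_tensorC_projective => //; apply: res_projective.
have mu_bij j : bijective (@mu R S C (res_obj Q j)).
  by apply: mu_projective_bij => //; apply: res_projective.
apply: (ext_at0_lifts (tensor_syzygy_exact m.+2) (extT _)).2 => f.
have [nu _ nuK] := mu_bij m.+1.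
pose q := nu (incl m.+1 \o f : {linear C -> T m.+1}).
have qE c : ten c q = incl m.+1 (f c).
  exact: (congr1 (fun h : {linear C -> T m.+1} => h c) (nuK _)).
have dq0 : res_d Q m q = 0.
  apply: (bij_inj (mu_bij m)); apply: linear_ext => c.
  rewrite -[LHS]/(ten c _) -[RHS]/(ten c 0) ten0r -D_ten qE.
  have := short_exact_comp0 (tensor_syzygy_exact m.+1) (f c).
  by move/image_proj_eq0.
have [q' dq'] := (@res_exactS _ _ Q m q).1 dq0.
exists (mu C q' : {linear C -> T m.+2}) => c.
apply: (image_incl_inj (f := D m.+1)).
rewrite -[LHS]/(D m.+1 (ten c q')) D_ten dq'.
exact: qE.
Qed.

(** Dimension shifting: raising the degree by one costs one more syzygy. *)
Lemma ext_at_tensor_syzygy_high k m : ext_at P k (X (k + m.+3)).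
Proof.
elim: k => [|k IHk]; first exact: ext_at0_tensor_syzygy.
apply: (ext_atS (tensor_syzygy_exact (k + m.+3))); last exact: IHk.
by apply: ext_at_tensorC_projective => //; apply: res_projective.
Qed.

Lemma ext_at_tensor_syzygy n : ultimately_closed_at (C : lmodType R) n ->
  forall m k, (m <= n.+3)%N -> ext_at P k (X m).
Proof.
(* Descending induction on [m] from n + 3, where Ext^1, ..., Ext^n vanish and hence all later Ext
   do. *)
move=> C_closed m k le_m; rewrite -(subKn le_m).
elim: (n.+3 - m)%N k (leq_subr m n.+3) => [|j IHj] k le_j.
  rewrite subn0; apply: (ultimately_closed_ext_all C_closed) => l ln.
  by rewrite -(subnKC (ltnW ln)) -!addnS; apply: ext_at_tensor_syzygy_high.
apply: (ext_at_pred (tensor_syzygy_exact (n.+3 - j.+1))).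
  by apply: ext_at_tensorC_projective => //; apply: res_projective.
by rewrite subnSK //; apply/IHj/ltnW.
Qed.

(** A five lemma argument. The two hypotheses say that maps from C to C (x) N lift to C (x) Q_0 and
    that maps from C to X_1 lift to C (x) Q_1. *)
Lemma mu_bij_of_ext : ext_at P 0 (X 1) -> ext_at P 0 (X 2) ->
  bijective (@mu R S C N).
Proof.
have extT j : ext_at P 0 (T j).
  by apply: ext_at_tensorC_projective => //; apply: res_projective.
have mu_bij j : bijective (@mu R S C (res_obj Q j)).
  by apply: mu_projective_bij => //; apply: res_projective.
move=> /(ext_at0_lifts (tensor_syzygy_exact 0) (extT 0%N)) lift0.
move=> /(ext_at0_lifts (tensor_syzygy_exact 1) (extT 1%N)) lift1.
have mu_eq0 x : (forall c : C, ten c x = 0 :> tensorC C N) -> x = 0.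
  have [q <-] := @res_aug_surj _ _ Q x => qx0.
  have [|f fE] := short_exact_factor (f := mu C q : {linear C -> T 0})
      (tensor_syzygy_exact 0).
    move=> c; rewrite -[LHS]/(tensorC_map C (res_aug Q) (ten c q)).
    by rewrite tensorC_mapE.
  have [h hE] := lift1 f; have [nu _ nuK] := mu_bij 1%N.
  have -> : q = res_d Q 0 (nu h); last by apply/res_exact0; exists (nu h).
  apply: (bij_inj (mu_bij 0%N)); apply: linear_ext => c.
  rewrite -[RHS]/(ten c _) -D_ten -fE -hE.
  congr (D 0 _); apply/esym.
  exact: (congr1 (fun g : {linear C -> T 1} => g c) (nuK h)).
have mu_inj : injective (@mu R S C N).
  move=> x y mu_xy; apply/eqP; rewrite -subr_eq0; apply/eqP/mu_eq0 => c.
  rewrite tenBr; apply/eqP; rewrite subr_eq0; apply/eqP.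
  exact: (congr1 (fun g : {linear C -> tensorC C N} => g c) mu_xy).
have mu_surj (f : homC C (tensorC C N)) : exists x, mu C x = f.
  have [h hE] := lift0 f; have [nu _ nuK] := mu_bij 0%N.
  exists (res_aug Q (nu h)); apply: linear_ext => c.
  rewrite -hE -[LHS]/(ten c _) -tensorC_mapE.
  congr (tensorC_map C _ _).
  exact: (congr1 (fun g : {linear C -> T 0} => g c) (nuK h)).
have [nu nuK] := choice mu_surj.
by exists nu => [x|f]; [apply: mu_inj | ]; rewrite nuK.
Qed.

End TensorSyzygies.

(** * Comparison of the three classes *)

Section Main.
Variables (R S : pzRingType) (C : bimodType R S) (N : lmodType S).

Lemma C_top_Auslander :
  semidualizing C -> ultimately_closed (C : lmodType R) ->
  C_top C N -> Auslander_class C N.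
Proof.
move=> C_semidualizing [n [n_gt0 C_closed]] N_top.
have [Q] := projective_resolution_exists N.
have [P] := projective_resolution_exists (C : lmodType R).
have ext m k :=
  @ext_at_tensor_syzygy R S C N C_semidualizing N_top Q P n C_closed m k.
split=> // [[|k] // _|].
  by apply/(Ext_vanishesS P); apply: (ext 0%N).
by apply: (mu_bij_of_ext C_semidualizing N_top (Q := Q) (P := P)); apply: ext.
Qed.

(** The adjoint [q] of a cocycle vanishes on the image of C (x) d_(k+1), which is the kernel of C
    (x) d_k as Tor vanishes. So [q] factors through C (x) d_k by injectivity of [I], and the adjoint
    of the factor bounds the cocycle. *)
Lemma C_top_perp : C_top C N -> perp_C_injective C N.
Proof.
move=> N_top X [I [I_inj [phi /linear_inverse[psi [phiK _]]]]] [//|k] _ Q f fd.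
have [q qE] := tensorC_lift (phi \o f : {linear _ -> _}).
have [|h hE] :=
    injective_factor (g := tensorC_map C (res_d Q k)) (f := q) I_inj.
  move=> x /(N_top _ (ltn0Sn k) Q)[u ->].
  apply: (@tensorC_ext _ _ _ _ _ (q \o tensorC_map C (res_d Q k.+1)) \0) => c y.
  rewrite -[LHS]/(q (tensorC_map C (res_d Q k.+1) (ten c y))) tensorC_mapE.
  by rewrite qE /= fd raddf0.
have [g gE] := tensorC_curry h.
exists (psi \o g : {linear _ -> _}) => x /=.
rewrite -[LHS]phiK; congr (psi _); apply: linear_ext => c.
by rewrite gE -tensorC_mapE hE qE.
Qed.

(** A cycle [t] that is no boundary is detected by some [q] into the character module that kills
    boundaries. The adjoint of [q] is a cocycle, hence a coboundary, so [q] factors through C (x)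
    d_k and kills [t]. *)
Lemma perp_C_top : perp_C_injective C N -> C_top C N.
Proof.
move=> N_perp [//|k] _ Q d t dt0.
apply: contrapT => not_im.
have [|q [q0 qt]] :=
    @character_separates R _ _ (tensorC_map C (res_d Q k.+1)) t.
  by move=> [u ut]; apply: not_im; exists u.
have [f fE] := tensorC_curry q.
have XC : C_injective C (homC C (character R) : lmodType S).
  exists (character R); split; first exact: character_injective.
  by exists (idfun : {linear _ -> _}); exists idfun.
have [|g gE] := N_perp _ XC k.+1 (ltn0Sn k) Q f.
  by move=> x; apply: linear_ext => c; rewrite fE -tensorC_mapE q0.
have [h hE] := tensorC_lift g.
apply: qt; suff -> : q t = h (tensorC_map C (res_d Q k) t).
  by rewrite [X in h X]dt0 raddf0.
apply: (@tensorC_ext _ _ _ _ _ q (h \o tensorC_map C (res_d Q k))) => c x.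
rewrite -[RHS]/(h (tensorC_map C (res_d Q k) (ten c x))) tensorC_mapE hE -gE.
by rewrite fE.
Qed.

End Main.

Theorem theorem1p3 (R S : pzRingType) (C : bimodType R S)
    (semidualizing_C : semidualizing C)
    (ultimately_closed_C : ultimately_closed (C : lmodType R)) :
  forall N : lmodType S,
    (Auslander_class C N <-> C_top C N) /\
    (C_top C N <-> perp_C_injective C N).
Proof.
move=> N; split; split.
- by case.
- exact: C_top_Auslander.
- exact: C_top_perp.
- exact: perp_C_top.
Qed.
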